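(* For integers $i\ge 0$ and $q\ge 5$ set $$p_i(q)= q\binom{q-1}{i} + \binom{q}{2}\binom{q-2}{i-1} + \sum_{s=2}^{q-3} q\binom{q-1}{s-1} \binom{\binom{q-s}{3} + \binom{q-1}{2}}{i-s+2} + q\binom{q-1}{2}\binom{\binom{q-1}{2}}{i-q+4} + q(q-1)\binom{\binom{q-1}{2}}{i-q+3} + q\binom{\binom{q-1}{2}}{i-q+2}.$$ For each fixed $i$, $p_i(q)$ is given by a polynomial in $q$ of degree $3i+2$. Moreover, for every integer $q\ge5$, every $i\le\binom{q}{3}$ and every square-free monomial ideal $I$ generated by $q$ square-free monomials, $$\beta_i(I^3)\le \binom{\binom{q}{3}}{i+1}+p_i(q)\qquad\text{and}\qquad \mathrm{pd}(I^3)\le\binom{q}{3}-1,$$ and these bounds are sharp in that equality holds for every $i$ when $I=\mathcal{E}_q$.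
   Context: Ideals are in polynomial rings over a field $\mathsf{k}$. $\beta_i(J)$ denotes the $i$-th (total) Betti number of the ideal $J$, i.e. the rank of the $i$-th free module in the minimal free resolution $\cdots\to F_1\to F_0\to J\to 0$ of $J$ (so $\beta_0(J)$ is the minimal number of generators of $J$), and $\mathrm{pd}(J)$ is the length of this resolution. Binomial coefficients $\binom{n}{k}$ with $k<0$ are $0$. With $[q]=\{1,\dots,q\}$, the $q$-extremal ideal $\mathcal{E}_q$ is the ideal of $\mathsf{k}[x_A : \emptyset\ne A\subseteq[q]]$ generated by the monomials $\epsilon_i=\prod_{A\subseteq [q],\, i\in A} x_A$, $i\in[q]$. *)

(* Defs.v *)
From HB Require Import structures.
From mathcomp Require Import all_boot all_order all_algebra.
From mathcomp Require Import mpoly.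
From Stdlib Require Import ClassicalEpsilon.

Set Implicit Arguments.
Unset Strict Implicit.
Unset Printing Implicit Defensive.

Import GRing.Theory.
Local Open Scope ring_scope.

(* Ideals are Prop-valued predicates on the ring: MathComp's [idealr] bundles
   a boolean membership test, which is not available for a generated ideal. *)
Definition ideal_gen (R : comNzRingType) (S : R -> Prop) (f : R) : Prop :=
  exists s : seq (R * R),
    (forall p, p \in s -> S p.2) /\ f = \sum_(p <- s) p.1 * p.2.

Definition ideal_mul (R : comNzRingType) (I J : R -> Prop) : R -> Prop :=
  ideal_gen (fun f => exists a b, [/\ I a, J b & f = a * b]).

Definition ideal_exp (R : comNzRingType) (I : R -> Prop) (r : nat) : R -> Prop :=
  iter r (ideal_mul I) (fun=> True).

Section FreeResolutions.

Variables (k : fieldType) (n : nat).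
Local Notation S := {mpoly k[n]}.

(* F_i = S^(rk i) is the module of row vectors with rk i entries, with the r-th
   basis vector in degree [deg i r]; F_(i+1) -> F_i is v |-> v *m diff i, and
   F_0 -> S is v |-> v *m aug. *)
Record free_seq := FreeSeq {
  rk : nat -> nat;
  deg : forall i, 'I_(rk i) -> nat;
  diff : forall i, 'M[S]_(rk i.+1, rk i);
  aug : 'cV[S]_(rk 0)
}.

Definition graded_seq (F : free_seq) : Prop :=
  (forall r, aug F r 0 \is (deg r).-homog) /\
  (forall i r c, diff F i r c = 0 \/
     exists2 d, deg r = (deg c + d)%N & diff F i r c \is d.-homog).

(* exactness of ... -> F_1 -> F_0 -> J -> 0 *)
Definition resolves (J : S -> Prop) (F : free_seq) : Prop :=
  [/\ forall f, J f <-> exists v, v *m aug F = f%:M,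
      forall v : 'rV_(rk F 0), v *m aug F = 0 <-> exists w, v = w *m diff F 0
    & forall i (v : 'rV_(rk F i.+1)), v *m diff F i = 0 <-> exists w, v = w *m diff F i.+1].

(* all entries of the differentials lie in the ideal (x_1, ..., x_n) *)
Definition minimal_seq (F : free_seq) : Prop :=
  forall i r c, (diff F i r c)@_0%MM = 0.

Definition minimal_free_resolution (J : S -> Prop) (F : free_seq) : Prop :=
  [/\ graded_seq F, resolves J F & minimal_seq F].

Definition zero_seq : free_seq :=
  @FreeSeq (fun=> 0%N) (fun _ _ => 0%N) (fun=> 0) 0.

(* Every homogeneous ideal has a minimal graded free resolution, unique up to
   isomorphism; [minres J] is a choice of one. *)
Definition minres (J : S -> Prop) : free_seq :=
  epsilon (inhabits zero_seq) (minimal_free_resolution J).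

Definition betti (J : S -> Prop) (i : nat) : nat := rk (minres J) i.

Definition has_length (F : free_seq) (l : nat) : Prop :=
  rk F l <> 0%N /\ forall j, (l < j)%N -> rk F j = 0%N.

(* meaningful for J <> 0 *)
Definition pd (J : S -> Prop) : nat :=
  epsilon (inhabits 0%N) (has_length (minres J)).

End FreeResolutions.

Definition squarefree_monom (n : nat) (m : 'X_{1..n}) : Prop :=
  forall j : 'I_n, (m j <= 1)%N.

Definition monomial_ideal (k : fieldType) (n q : nat) (m : 'I_q -> 'X_{1..n}) :
    {mpoly k[n]} -> Prop :=
  ideal_gen (fun f => exists i, f = 'X_[m i]).

(* The variables x_A are indexed by the nonempty A : {set 'I_q}, transported to
   ordinals along [enum_rank]. *)
Definition nonempty_set (q : nat) : finType := {A : {set 'I_q} | A != set0}.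

Definition extremal_gen (k : fieldType) (q : nat) (i : 'I_q) :
    {mpoly k[#|nonempty_set q|]} :=
  \prod_(A : nonempty_set q | i \in val A) 'X_(enum_rank A).

Definition extremal_ideal (k : fieldType) (q : nat) :
    {mpoly k[#|nonempty_set q|]} -> Prop :=
  ideal_gen (fun f => exists i, f = extremal_gen k i).

(* binomial coefficient with an integer lower index, zero when it is negative *)
Definition binZ (n : nat) (j : int) : nat :=
  if j is Posz j' then 'C(n, j') else 0%N.

(* The upper indices below are true differences for q >= 5 (and s <= q - 3);
   the lower indices are computed in int. *)
Definition p_ (i q : nat) : nat :=
  let iz := i%:Z in
  let qz := q%:Z in
  (q * 'C(q - 1, i)
   + 'C(q, 2) * binZ (q - 2) (iz - 1)%R
   + \sum_(2 <= s < q - 2)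
       q * 'C(q - 1, s - 1) * binZ ('C(q - s, 3) + 'C(q - 1, 2)) (iz - s%:Z + 2)%R
   + q * 'C(q - 1, 2) * binZ 'C(q - 1, 2) (iz - qz + 4)%R
   + q * (q - 1) * binZ 'C(q - 1, 2) (iz - qz + 3)%R
   + q * binZ 'C(q - 1, 2) (iz - qz + 2)%R)%N.

(* Main.v *)
Require Import Defs.
From mathcomp Require Import all_boot all_order all_algebra.
From mathcomp Require Import mpoly zify ring.
From Stdlib Require Import Classical ClassicalEpsilon FunctionalExtensionality.

(** Write e_1, ..., e_q for the standard basis of Z^q. The products of three of the q
    generators m_1, ..., m_q are indexed by the vectors a >= 0 with |a| = 3, that is, by
    the vectors 3e_i, 2e_i + e_j and e_i + e_j + e_k, and for square-free m_i the
    exponent of a variable x in the product indexed by a is a(A), the sum of the a_i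
    over the set A of those i with x dividing m_i.

    One simplicial complex on these vectors, [scarf], serves every square-free ideal I
    with q generators. Labelled by the products, it supports a free resolution of I^3 as
    soon as, for each monomial u, the faces whose labels divide u form an acyclic
    complex or have no vertices ([simplicial_resolves]). The vertices that occur below u
    are those with a(A) bounded by a function of A, so they form a set closed under a
    combinatorial lcm operation; for such a set, the vertices 3e_i and then the
    vertices 2e_i + e_j can be deleted one at a time, because the link of each is a
    cone, until a simplex is left ([ok_scarf_acyclic]). The number of faces with i + 1
    vertices is binomial(binomial(q, 3), i + 1) + p_i(q) ([card_scarf_faces]).

    A minimal resolution has in each degree at most the rank of any other resolution of
    the same ideal, since modulo the variables a comparison map out of it is split
    injective ([minimal_rk_le]); this gives the upper bounds. For the ideal E_q there is
    a variable x_A for every nonempty A, and each vertex v of a face has some A on which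
    it exceeds all other vertices of the face ([scarf_strict]). Deleting v therefore
    changes the lcm of the labels, the simplicial resolution is minimal, and the bounds
    are attained.

    As [betti] and [pd] refer to a chosen minimal graded resolution, one has to exist
    for every third power ([minimal_resolution_exists]): polynomial rings are noetherian
    ([noetherian]), so minimal homogeneous generators can be chosen for the ideal, for
    their syzygies, and so on. Polynomiality of p_i ([p_polynomial]) is read off after
    all the summands but the first two are written as a single sum over s ([p_E]). *)

Set Implicit Arguments.
Unset Strict Implicit.
Unset Printing Implicit Defensive.

Import Order.Theory GRing.Theory Num.Theory.
Local Open Scope ring_scope.

(** * Ranks of minimal resolutions *)

Lemma dep_choice (A : Type) (B : A -> Type) (P : forall x, B x -> Prop) :
  (forall x, exists y, P x y) -> exists f : forall x, B x, forall x, P x (f x).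
Proof.
move=> exP; exists (fun x => proj1_sig (constructive_indefinite_description _ (exP x))).
by move=> x; apply: proj2_sig.
Qed.

Section Comparison.

Variables (k : fieldType) (n : nat).
Local Notation S := {mpoly k[n]}.
Implicit Types (F G : free_seq k n) (J : S -> Prop).

(** The augmentation counts as the differential onto a free module of rank one placed in
    degree 0, so that exactness and lifting are uniform in the degree. *)
Definition aug_rk F (i : nat) : nat := if i is j.+1 then rk F j else 1.

Definition aug_diff F (i : nat) : 'M[S]_(aug_rk F i.+1, aug_rk F i) :=
  match i with 0 => aug F | j.+1 => diff F j end.

Lemma aug_exact J F i (v : 'rV[S]_(aug_rk F i.+1)) : resolves J F ->
  v *m aug_diff F i = 0 <-> exists w, v = w *m aug_diff F i.+1.
Proof. by case=> _ ex0 exS; case: i v => [|i] v; [apply: ex0 | apply: exS]. Qed.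

Lemma lift_rows (m b a : nat) (X : 'M[S]_(m, a)) (D : 'M[S]_(b, a)) :
  (forall r, exists w : 'rV_b, row r X = w *m D) -> exists Y, X = Y *m D.
Proof.
move=> hX; have [w wE] := dep_choice hX; exists (\matrix_r w r).
by apply/row_matrixP => r; rewrite row_mul rowK wE.
Qed.

Lemma lift_kernel J F i m (X : 'M[S]_(m, aug_rk F i.+1)) : resolves J F ->
  X *m aug_diff F i = 0 -> exists Y, X = Y *m aug_diff F i.+1.
Proof.
move=> resF X0; apply: lift_rows => r; apply/(aug_exact _ resF).
by rewrite -row_mul X0 row0.
Qed.

Lemma aug_diff_sq J F i : resolves J F -> aug_diff F i.+1 *m aug_diff F i = 0.
Proof.
move=> resF; apply/row_matrixP => r; rewrite row_mul row0.
by apply/(aug_exact _ resF); exists (delta_mx 0 r); rewrite rowE.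
Qed.

Lemma lift_aug J F G : resolves J F -> resolves J G ->
  exists Y, aug F = Y *m aug G.
Proof.
move=> [augF _ _] [augG _ _]; apply: lift_rows => r.
have rE : row r (aug F) = (aug F r 0)%:M by apply/matrixP => x y; rewrite !ord1 !mxE eqxx.
rewrite rE; have /augG[w <-] : J (aug F r 0); last by exists w.
by apply/augF; exists (delta_mx 0 r); rewrite -rowE.
Qed.

Local Notation const := (map_mx (mcoeff (R := k) (n := n) 0%MM)).

Lemma const_diff F i : minimal_seq F -> const (diff F i) = 0.
Proof. by move=> minF; apply/matrixP => r c; rewrite !mxE minF. Qed.

Lemma lift_homotopy J F G i (f : 'M_(aug_rk F i, aug_rk G i)) g
    (h : 'M_(aug_rk F i, aug_rk F i.+1)) f' g' : resolves J F ->
  aug_diff F i *m f = f' *m aug_diff G i ->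
  aug_diff G i *m g = g' *m aug_diff F i ->
  aug_diff F i *m (1%:M - f *m g - h *m aug_diff F i) = 0 ->
  exists h', 1%:M - f' *m g' - aug_diff F i *m h = h' *m aug_diff F i.+1.
Proof.
move=> resF f'E g'E hE.
apply: (lift_kernel resF); rewrite !mulmxBl mul1mx -mulmxA -g'E mulmxA -f'E.
by rewrite -[RHS]hE !mulmxBr mulmx1 !mulmxA.
Qed.

(** The comparison theorem, one degree at a time: f and g are the degree i components of
    chain maps lifting the identity of J, and h is the component of a homotopy from
    their composite to the identity. Asserting that the next components exist, rather
    than naming them, lets a plain induction replace the construction of infinite
    sequences of dependently typed matrices. The last clause holds in degree 0 by the
    choice h = 0 (the augmentation may have constant entries, when J is the whole ring)
    and in higher degrees by minimality. *)
Lemma comparison_step J F G i : resolves J F -> resolves J G -> minimal_seq F ->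
  exists (f : 'M_(aug_rk F i, aug_rk G i)) (g : 'M_(aug_rk G i, aug_rk F i))
         (h : 'M_(aug_rk F i, aug_rk F i.+1)),
  [/\ exists f', aug_diff F i *m f = f' *m aug_diff G i,
      exists g', aug_diff G i *m g = g' *m aug_diff F i,
      aug_diff F i *m (1%:M - f *m g - h *m aug_diff F i) = 0
    & const (aug_diff F i *m h) = 0].
Proof.
move=> resF resG minF; elim: i => [|i [f [g [h [[f' f'E] [g' g'E] hE ch]]]]].
  exists 1%:M, 1%:M, 0; split.
  - by rewrite mulmx1; apply: lift_aug resF resG.
  - by rewrite mulmx1; apply: lift_aug resG resF.
  - by rewrite mulmx1 subrr mul0mx subr0 mulmx0.
  - by rewrite mulmx0 map_mx0.
have [h' h'E] := lift_homotopy resF f'E g'E hE.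
exists f', g', h'; split.
- apply: (lift_kernel resG).
  by rewrite -mulmxA -f'E mulmxA (aug_diff_sq _ resF) mul0mx.
- apply: (lift_kernel resF).
  by rewrite -mulmxA -g'E mulmxA (aug_diff_sq _ resG) mul0mx.
- rewrite -h'E opprB addrC subrK mulmxA (aug_diff_sq _ resF).
  by rewrite mul0mx.
- by rewrite /= map_mxM const_diff // mul0mx.
Qed.

(** Modulo the variables the differentials of F vanish, so the homotopy formula turns
    the composite F -> G -> F into the identity. Hence the map F -> G is injective over
    the field k in each degree. *)
Lemma minimal_rk_le J F G i : resolves J F -> resolves J G -> minimal_seq F ->
  (rk F i <= rk G i)%N.
Proof.
move=> resF resG minF.
have [f [g [h [[f' f'E] [g' g'E] hE ch]]]] := comparison_step i resF resG minF.
have [h' h'E] := lift_homotopy resF f'E g'E hE.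
have fg1 : const f' *m const g' = 1%:M.
  have c1 : const (1%:M : 'M_(aug_rk F i.+1)) = 1%:M by rewrite map_mx1.
  apply/eqP; rewrite eq_sym -subr_eq0 -c1 -map_mxM -map_mxB.
  have -> : 1%:M - f' *m g' = h' *m aug_diff F i.+1 + aug_diff F i *m h.
    by rewrite -h'E subrK.
  by rewrite map_mxD ch addr0 map_mxM /= const_diff // mulmx0.
rewrite -[X in (X <= _)%N](mxrank1 k) -fg1.
exact: leq_trans (mxrankM_maxl _ _) (rank_leq_col _).
Qed.

End Comparison.

(** * Finite generation over polynomial rings *)

(** Choose, again and again, an index at which the rest of the sequence is minimal. *)
Lemma ex_nondecreasing_subseq (u : nat -> nat) : exists phi : nat -> nat,
  {homo phi : i j / (i < j)%N} /\ {homo u \o phi : i j / (i <= j)%N}.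
Proof.
have argmin N : exists m, (N <= m)%N /\ forall t, (N <= t)%N -> (u m <= u t)%N.
  suff minor x : forall m, (N <= m)%N -> (u m < x)%N ->
      exists m, (N <= m)%N /\ forall t, (N <= t)%N -> (u m <= u t)%N.
    exact: (minor _ _ (leqnn N) (ltnSn _)).
  elim: x => // x IH m le_Nm le_m.
  have [[t [le_Nt lt_t]]|no] := excluded_middle_informative
     (exists t, (N <= t)%N /\ (u t < u m)%N).
    by apply: (IH t) => //; apply: leq_trans lt_t _.
  exists m; split=> // t le_Nt; rewrite leqNgt; apply/negP => lt_t.
  by apply: no; exists t.
have [g gP] := dep_choice argmin.
pose phi := fix phi t := if t is t'.+1 then g (phi t').+1 else g 0.
have phi_lt : {homo phi : i j / (i < j)%N}.
  by apply: homo_ltn => [j i l|t]; [exact: ltn_trans | exact: (gP _).1].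
exists phi; split=> // i j; rewrite leq_eqVlt => /predU1P[-> //|lt_ij].
have [N [phiE le_N]] : exists N, phi i = g N /\ (N <= phi i)%N.
  by case: i {lt_ij} => [|i]; eexists; split; try reflexivity; exact: (gP _).1.
rewrite /= phiE; apply: (gP N).2; apply: leq_trans le_N _.
exact/ltnW/phi_lt.
Qed.

(** Refine to a subsequence that is nondecreasing in one variable after the other. *)
Lemma dickson n (u : nat -> 'X_{1..n}) :
  exists i j, (i < j)%N /\ (u i <= u j)%MM.
Proof.
suff /(_ (enum 'I_n))[phi [phi_lt phi_le]] (s : seq 'I_n) : exists phi : nat -> nat,
    {homo phi : i j / (i < j)%N} /\
    forall k, k \in s -> {homo (fun i => u (phi i) k) : i j / (i <= j)%N}.
  exists (phi 0%N), (phi 1%N); split; first exact: phi_lt.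
  by apply/mnm_lepP => k; apply: phi_le; rewrite ?mem_enum.
elim: s => [|x s [phi [phi_lt phi_le]]]; first by exists id; split.
have [psi [psi_lt psi_le]] := ex_nondecreasing_subseq (fun i => u (phi i) x).
exists (phi \o psi); split=> [i j /psi_lt/phi_lt //|k].
rewrite inE => /predU1P[-> // | ks] i j le_ij /=.
apply: phi_le => //; exact: (ltnW_homo psi_lt).
Qed.

Section Noetherian.

Variables (k : fieldType) (n : nat).
Local Notation S := {mpoly k[n]}.

Definition seq_span (s : seq S) (f : S) : Prop :=
  exists c : nat -> S, f = \sum_(i < size s) c i * s`_i.

Lemma seq_span0 s : seq_span s 0.
Proof. by exists (fun=> 0); rewrite big1 // => i _; rewrite mul0r. Qed.

Lemma seq_span_lin s a f g : seq_span s f -> seq_span s g -> seq_span s (f + a * g).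
Proof.
move=> [c ->] [d ->]; exists (fun i => c i + a * d i).
by rewrite mulr_sumr -big_split /=; apply: eq_bigr => i _; rewrite mulrDl mulrA.
Qed.

Lemma seq_span_mem s i : (i < size s)%N -> seq_span s s`_i.
Proof.
move=> lt_is; exists (fun j => (j == i)%:R).
rewrite (bigD1 (Ordinal lt_is)) //= eqxx mul1r big1 ?addr0 // => j ne_ji.
by rewrite -val_eqE /= in ne_ji; rewrite (negPf ne_ji) mul0r.
Qed.

(** One step of the division algorithm. *)
Lemma lead_cancel (f g : S) : f != 0 -> g != 0 -> (mlead f <= mlead g)%MM ->
  let h := g - (mleadc g / mleadc f) *: (f * 'X_[mlead g - mlead f]) in
  h != 0 -> (mlead h < mlead g)%O.
Proof.
move=> nzf nzg lefg h nzh; rewrite lt_neqAle; apply/andP; split.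
  have: h@_(mlead h) != 0 by rewrite mleadc_eq0.
  apply: contraNneq => ->; rewrite mcoeffB mcoeffZ -{3}(submK lefg) mcoeffMX.
  by rewrite divfK ?mleadc_eq0 // subrr.
apply: le_trans (mleadB_le _ _) _.
rewrite leUx lexx /=.
apply: le_trans (mleadZ_le _ _) _.
by apply: le_trans (mleadM_le _ _) _; rewrite mleadXm addmC submK.
Qed.

(** Otherwise choose elements g_0, g_1, ... of L, each with the least leading monomial
    among the elements of L outside the ideal generated by its predecessors. By
    Dickson's lemma the leading monomial of some g_i divides that of a later g_j;
    reducing g_j by g_i leaves an element that is still outside the ideal and has a
    smaller leading monomial. *)
Lemma ideal_fin_gen (L : S -> Prop) : L 0 ->
  (forall a f g, L f -> L g -> L (f + a * g)) ->
  exists s : seq S, forall f, L f <-> seq_span s f.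
Proof.
move=> L0 Llin; apply: NNPP => not_fg.
have bad (s : seq S) : exists f, (forall i, (i < size s)%N -> L s`_i) ->
    [/\ L f, ~ seq_span s f
      & forall g, L g -> ~ seq_span s g -> ~~ (mlead g < mlead f)%O].
  have [sL|] := excluded_middle_informative (forall i, (i < size s)%N -> L s`_i); last first.
    by exists 0.
  have [f [Lf nf]] : exists f, L f /\ ~ seq_span s f.
    apply: NNPP => no; apply: not_fg; exists s => f; split=> [Lf|[c ->]].
      by apply: NNPP => nf; apply: no; exists f.
    elim/big_ind: _ => // [g h Lg Lh|i _]; first by rewrite -[h]mul1r; apply: Llin.
    by rewrite -[_ * _]add0r; apply: Llin => //; apply: sL.
  have [m mE] : exists m, mlead f = m by exists (mlead f).
  elim/(@ltmwf n): m f mE Lf nf => m IH f mE Lf nf.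
  have [[g [Lg ng lt_gf]]|no] := excluded_middle_informative
    (exists g, [/\ L g, ~ seq_span s g & (mlead g < mlead f)%O]).
    by apply: (IH (mlead g)) => //; rewrite -mE.
  exists f => _; split=> // g Lg ng; apply/negP => lt_gf.
  by apply: no; exists g.
have [next nextP] := dep_choice bad.
pose pre := fix pre j := if j is i.+1 then rcons (pre i) (next (pre i)) else [::].
pose g j := next (pre j).
have preE j : pre j = mkseq g j by elim: j => // j IH; rewrite mkseqS -IH.
have gP j : [/\ L (g j), ~ seq_span (pre j) (g j)
   & forall f, L f -> ~ seq_span (pre j) f -> ~~ (mlead f < mlead (g j))%O].
  apply: (nextP _); elim: j => [//|j IH] i /=.
  rewrite size_rcons ltnS leq_eqVlt nth_rcons => /predU1P[-> | lt_ij]; last first.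
    by rewrite lt_ij; apply: IH.
  by rewrite ltnn eqxx; case: (nextP _ IH).
have nzg j : g j != 0.
  by apply/eqP => g0; case: (gP j) => _ + _; rewrite g0; case; apply: seq_span0.
have [i [j [lt_ij le_ij]]] := dickson (fun i => mlead (g i)).
have [Lgj ngj minj] := gP j; have [Lgi _ _] := gP i.
have gi_span : seq_span (pre j) (g i).
  have := @seq_span_mem (pre j) i; rewrite preE size_mkseq nth_mkseq //; exact.
pose a := - (mleadc (g j) / mleadc (g i))%:MP * 'X_[mlead (g j) - mlead (g i)].
have := lead_cancel (nzg i) (nzg j) le_ij.
set h := _ - _; have hE : h = g j + a * g i.
  by rewrite /h /a -mul_mpolyC mulNr mulNr -mulrA [_ * g i]mulrC.
have nh : ~ seq_span (pre j) h.
  move=> sh; apply: ngj; have -> : g j = h + (- a) * g i by rewrite hE mulNr addrK.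
  exact: seq_span_lin.
move=> lt_h; have /negP := minj h (eq_ind_r L (Llin _ _ _ Lgj Lgi) hE) nh.
by apply; apply: lt_h; apply/eqP => h0; apply: nh; rewrite h0; apply: seq_span0.
Qed.

Definition submodule a (M : 'rV[S]_a -> Prop) : Prop :=
  M 0 /\ forall (c : S) u v, M u -> M v -> M (u + c *: v).

Lemma submodule_mulmx a b (M : 'rV[S]_a -> Prop) (W : 'M[S]_(b, a)) w :
  submodule M -> (forall r, M (row r W)) -> M (w *m W).
Proof.
move=> [M0 Mlin] MW; rewrite mulmx_sum_row; elim/big_ind: _ => // [u v Mu Mv|i _].
  by rewrite -[v]scale1r; apply: Mlin.
by rewrite -[_ *: _]add0r; apply: Mlin.
Qed.

Definition row_span b a (W : 'M[S]_(b, a)) (v : 'rV[S]_a) : Prop :=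
  exists w, v = w *m W.

Lemma submodule_row_span a b (W : 'M[S]_(b, a)) : submodule (row_span W).
Proof.
split=> [|c _ _ [u ->] [v ->]]; first by exists 0; rewrite mul0mx.
by exists (u + c *: v); rewrite mulmxDl scalemxAl.
Qed.

Lemma row_span_row a b (W : 'M[S]_(b, a)) r : row_span W (row r W).
Proof. by exists (delta_mx 0 r); rewrite rowE. Qed.

(** Induction on the rank: the first coordinates of the elements of M form an ideal, and
    the elements with first coordinate 0 form a submodule of a free module of smaller
    rank. *)
Lemma noetherian a (M : 'rV[S]_a -> Prop) : submodule M ->
  exists b (W : 'M_(b, a)), forall v, M v <-> row_span W v.
Proof.
elim: a M => [|a IH] M Msub; have [M0 Mlin] := Msub.
  exists 0, 0 => v; rewrite thinmx0; split=> // _; exists 0.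
  by rewrite [RHS]thinmx0.
pose L f := exists2 v, M v & v 0 0 = f.
have [||s sP] := @ideal_fin_gen L.
- by exists 0; rewrite ?mxE.
- by move=> c _ _ [u Mu <-] [v Mv <-]; exists (u + c *: v); rewrite ?mxE //; apply: Mlin.
have lift (i : 'I_(size s)) : exists v, M v /\ v 0 0 = s`_i.
  by have /sP[v] := seq_span_mem (ltn_ord i); exists v.
have [V_ V_P] := dep_choice lift.
pose V := \matrix_i V_ i.
have VP i : M (row i V) /\ V i 0 = s`_i by rewrite rowK mxE; apply: V_P.
have [|b [W WP]] := IH (fun w => M (row_mx (0 : 'M_1) w)).
  split=> [|c u v Mu Mv]; first by rewrite row_mx0.
  have -> : row_mx 0 (u + c *: v) = row_mx (0 : 'M_1) u + c *: row_mx 0 v.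
    by rewrite scale_row_mx add_row_mx scaler0 addr0.
  exact: Mlin.
exists (size s + b)%N, (col_mx V (row_mx (0 : 'M_(b,1)) W)) => v; split=> [Mv|[w ->]]; last first.
  apply: (submodule_mulmx _ Msub) => i; case: (split_ordP i) => j ->.
    by rewrite rowKu; apply: (VP j).1.
  rewrite rowKd.
  rewrite (@row_row_mx _ b 1 a) row0; apply/WP; exists (delta_mx 0 j); exact: rowE.
have /sP[c vE] : L (v 0 0) by exists v.
pose w : 'rV_(size s) := \row_i c i.
pose v' := v - w *m V.
have Mv' : M v'.
  rewrite /v' -scaleN1r; apply: Mlin => //.
  by apply: (submodule_mulmx _ Msub) => i; apply: (VP i).1.
have v'0 : v' 0 0 = 0.
  rewrite !mxE vE; apply/eqP; rewrite subr_eq0; apply/eqP; apply: eq_bigr => i _.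
  by rewrite mxE (VP i).2.
have v'E : v' = row_mx (0 : 'M_1) (@rsubmx _ 1 1 a v').
  have <- : @lsubmx _ 1 1 a v' = 0; last by rewrite (@hsubmxK _ 1 1 a).
  apply/matrixP => x y; rewrite !ord1 [LHS]mxE [RHS]mxE -v'0.
  by congr (v' 0 _); apply: val_inj.
have /WP[w' w'E] : M (row_mx (0 : 'M_1) (@rsubmx _ 1 1 a v')) by rewrite -v'E.
exists (row_mx w w'); rewrite mul_row_col (@mul_mx_row _ 1 b 1 a) mulmx0 -w'E -v'E.
by rewrite /v' addrC subrK.
Qed.

End Noetherian.

(** * Existence of minimal graded resolutions *)

Section MinimalResolution.

Variables (k : fieldType) (n : nat).
Local Notation S := {mpoly k[n]}.

Lemma mcoeff_pihomog d (p : S) m :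
  (pihomog mdeg d p)@_m = if mdeg m == d then p@_m else 0.
Proof.
rewrite pihomogE raddf_sum /= -big_filter.
have -> : \sum_(m' <- [seq m' <- msupp p | mdeg m' == d]) (p@_m' *: 'X_[m'])@_m
    = \sum_(m' <- [seq m' <- msupp p | mdeg m' == d]) if m' == m then p@_m else 0.
  apply: eq_bigr => m' _; rewrite mcoeffZ mcoeffX.
  by case: eqP => [->|_]; rewrite ?mulr1 ?mulr0.
rewrite -big_mkcond big_const_seq.
have := count_uniq_mem m (filter_uniq (fun m' => mdeg m' == d) (msupp_uniq p)).
rewrite /pred1 /= => ->; rewrite mem_filter.
case: (mdeg m == d) => //=.
by case: (boolP (m \in msupp p)) => [_|/memN_msupp_eq0->]; rewrite /= ?addr0.
Qed.

Lemma pihomogMr d e (p x : S) : x \is d.-homog ->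
  pihomog mdeg e (p * x) = if (d <= e)%N then pihomog mdeg (e - d) p * x else 0.
Proof.
move=> hx; pose N := (msize p + e.+1)%N.
have pE : p = \sum_(j < N) pihomog mdeg j p.
  by apply: pihomog_partitionE; rewrite leq_addr.
rewrite {1}pE mulr_suml raddf_sum /=.
have hpx j : pihomog mdeg j p * x \is (j + d).-homog by rewrite dhomogM ?pihomogP.
case: leqP => [le_de|lt_ed]; last first.
  rewrite big1 // => j _; apply: (pihomog_ne0 _ (hpx j)).
  by rewrite gtn_eqF // ltn_addl.
have lt_N : (e - d < N)%N by rewrite /N addnS ltnS (leq_trans (leq_subr _ _)) ?leq_addl.
rewrite (bigD1 (Ordinal lt_N)) //= big1 => [|j ne_j].
  by rewrite addr0 pihomog_dE // -{2}(subnK le_de).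
apply: (pihomog_ne0 _ (hpx j)); apply: contraNneq ne_j => je.
by rewrite -val_eqE /= -je addnK.
Qed.

(** The components are allowed to vanish, in any degree, as in [graded_seq]. *)
Definition homog_row a (dg : 'I_a -> nat) (D : nat) (v : 'rV[S]_a) : Prop :=
  forall c, v 0 c = 0 \/ exists2 d, D = (dg c + d)%N & v 0 c \is d.-homog.

Definition row_part a (dg : 'I_a -> nat) (D : nat) (v : 'rV[S]_a) : 'rV[S]_a :=
  \row_c (if (dg c <= D)%N then pihomog mdeg (D - dg c) (v 0 c) else 0).

Lemma homog_row_part a (dg : 'I_a -> nat) D v : homog_row dg D (row_part dg D v).
Proof.
move=> c; rewrite mxE; case: leqP => [le_cD|_]; last by left.
by right; exists (D - dg c)%N; rewrite ?subnKC ?pihomogP.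
Qed.

Lemma sum_row_part a (dg : 'I_a -> nat) (v : 'rV[S]_a) :
  exists N, forall N', (N <= N')%N -> v = \sum_(D < N') row_part dg D v.
Proof.
exists (\max_c (dg c + msize (v 0%R c)))%N => N le_N.
apply/rowP => c; rewrite summxE; apply/mpolyP => m; rewrite raddf_sum /=.
have [lt_m|ge_m] := ltnP (dg c + mdeg m) N; last first.
  rewrite (memN_msupp_eq0 (msize_mdeg_ge _)) ?big1 // => [D _|].
    rewrite mxE; case: leqP => [le_D|_]; last by rewrite mcoeff0.
    rewrite mcoeff_pihomog; case: eqP => // mE.
    by have := ltn_ord D; rewrite -(subnKC le_D) -mE ltnNge ge_m.
  rewrite -(leq_add2l (dg c)); apply: leq_trans ge_m; apply: leq_trans le_N.
  exact: (leq_bigmax c).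
rewrite (bigD1 (Ordinal lt_m)) //= mxE leq_addr addKn mcoeff_pihomog eqxx.
rewrite big1 ?addr0 // => D; rewrite -val_eqE /= => neD.
rewrite mxE; case: leqP => [le_D|_]; last by rewrite mcoeff0.
rewrite mcoeff_pihomog; case: eqP => // mE; case/eqP: neD.
by rewrite mE subnKC.
Qed.

Lemma row_part_mulmx a b (dg : 'I_a -> nat) (dgW : 'I_b -> nat) (W : 'M[S]_(b, a)) D w :
  (forall r, homog_row dg (dgW r) (row r W)) ->
  row_part dg D (w *m W) = row_part dgW D w *m W.
Proof.
move=> hW; apply/rowP => c; rewrite !mxE.
transitivity (\sum_j if (dg c <= D)%N then pihomog mdeg (D - dg c) (w 0 j * W j c) else 0).
  by case: leqP => _; rewrite ?raddf_sum // big1.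
apply: eq_bigr => r _; rewrite mxE.
have := hW r c; rewrite mxE => -[->|[d rE hd]].
  by rewrite !mulr0 pihomog0 if_same.
rewrite rE; case: leqP => [le_c|lt_c]; last first.
  by rewrite leqNgt ltn_addr ?mul0r.
by rewrite (pihomogMr _ _ hd) leq_subRL // subnDA; case: leqP; rewrite ?mul0r.
Qed.

Definition graded_submodule a (dg : 'I_a -> nat) (M : 'rV[S]_a -> Prop) : Prop :=
  submodule M /\ forall D v, M v -> M (row_part dg D v).

Definition gens a (dg : 'I_a -> nat) (M : 'rV[S]_a -> Prop) b
    (dgW : 'I_b -> nat) (W : 'M[S]_(b, a)) : Prop :=
  (forall r, homog_row dg (dgW r) (row r W)) /\ (forall v, M v <-> row_span W v).

(** The homogeneous parts of finitely many generators. *)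
Lemma homogeneous_gens a (dg : 'I_a -> nat) M : graded_submodule dg M ->
  exists b (dgW : 'I_b -> nat) (W : 'M_(b, a)), gens dg M dgW W.
Proof.
move=> [Msub Mh]; have [b [W WP]] := noetherian Msub.
have [N NP] : exists N, forall i, row i W = \sum_(D < N) row_part dg D (row i W).
  have [N_ N_P] := dep_choice (fun i => sum_row_part dg (row i W)).
  by exists (\max_i N_ i)%N => i; apply: N_P; apply: (leq_bigmax i).
pose I := ('I_b * 'I_N)%type.
pose row_ (x : I) := row_part dg x.2 (row x.1 W).
pose V := \matrix_(r < #|{: I}|) row_ (enum_val r).
exists #|{: I}|, (fun r => nat_of_ord (enum_val r : I).2), V.
split=> [r|v]; first by rewrite rowK; apply: homog_row_part.
split=> [/WP[w ->]|[w ->]]; last first.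
  apply: (submodule_mulmx _ Msub) => r; rewrite rowK; apply: Mh.
  exact/WP/row_span_row.
apply: (submodule_mulmx _ (submodule_row_span _)) => i.
rewrite NP; have [s0 slin] := submodule_row_span V.
elim/big_ind: _ => // [x y sx sy|D _]; first by rewrite -[y]scale1r; apply: slin.
have -> : row_part dg D (row i W) = row (enum_rank (i, D)) V by rewrite rowK enum_rankK.
exact: row_span_row.
Qed.

(** By homogeneity, an entry with nonzero constant coefficient of a homogeneous syzygy
    is a nonzero scalar, and the corresponding generator is then a combination of the
    others and can be dropped. Generators are dropped until no such syzygy is left. *)
Lemma minimal_gens a (dg : 'I_a -> nat) M : graded_submodule dg M ->
  exists b (dgW : 'I_b -> nat) (W : 'M_(b, a)), gens dg M dgW W /\
    forall D w, homog_row dgW D w -> w *m W = 0 -> forall r, (w 0 r)@_0%MM = 0.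
Proof.
move=> /homogeneous_gens[b [dgW [W]]]; elim: b dgW W => [|b IH] dgW W [hW WP].
  by exists 0%N, dgW, W; split=> // D w _ _ [].
have [syz|nsyz] := classic (forall D w, homog_row dgW D w -> w *m W = 0 ->
    forall r, (w 0 r)@_0%MM = 0); first by exists b.+1, dgW, W.
have [D [w [r [hw w0 /eqP wr]]]] : exists D w r,
    [/\ homog_row dgW D w, w *m W = 0 & (w 0 r)@_0%MM <> 0].
  apply: NNPP => no; apply: nsyz => D w hw w0 r; apply: NNPP => wr.
  by apply: no; exists D, w, r.
pose c := (w 0 r)@_0%MM; have wrE : w 0 r = c%:MP.
  case: (hw r) => [w0r|[d _ hd]]; first by rewrite w0r mcoeff0 eqxx in wr.
  have d0 : 0%N = d.
    by rewrite -(@mdeg0 n); apply: (dhomog_mf hd); rewrite mcoeff_msupp.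
  apply/mpolyP => m; rewrite mcoeffC; have [->|nz_m] := eqVneq m 0%MM.
    by rewrite mulr1.
  by rewrite mulr0 (dhomog_nemf_coeff hd) // -d0 mdeg_eq0.
have rowE' j : row j (row' r W) = row (lift r j) W by apply/rowP=> x; rewrite !mxE.
have span_r : row_span (row' r W) (row r W).
  have -> : row r W = (- (c^-1)%:MP) *: (\row_j w 0 (lift r j) *m row' r W).
    have := w0; rewrite mulmx_sum_row (bigD1_ord r) //= wrE => /eqP.
    rewrite addr_eq0 => /eqP rE.
    have /(congr1 (fun v => (c^-1)%:MP *: v)) := rE.
    rewrite scalerA -mpolyCM mulVf // mpolyC1 scale1r => ->.
    rewrite scalerN scaleNr mulmx_sum_row; congr (- (_ *: _)).
    by apply: eq_bigr => j _; rewrite mxE rowE'.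
  by rewrite scalemxAl; eexists; reflexivity.
apply: (IH (dgW \o lift r) (row' r W)); split=> [j|v].
  by rewrite rowE'; apply: hW.
split=> [/WP[u ->]|[u ->]].
  apply: (submodule_mulmx _ (submodule_row_span _)) => i.
  case: (unliftP r i) => [j ->|-> //].
  by rewrite -rowE'; apply: row_span_row.
apply/WP; apply: (submodule_mulmx _ (submodule_row_span _)) => j.
by rewrite rowE'; apply: row_span_row.
Qed.

Record gen_mx a := GenMx {
  gm_rk : nat; gm_deg : 'I_gm_rk -> nat; gm_mx : 'M[S]_(gm_rk, a) }.

Definition minimal_gen_mx a (dg : 'I_a -> nat) M (G : gen_mx a) : Prop :=
  gens dg M (@gm_deg _ G) (gm_mx G) /\
  forall D w, homog_row (@gm_deg _ G) D w -> w *m gm_mx G = 0 ->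
    forall r, (w 0 r)@_0%MM = 0.

(** A graded free module and chosen homogeneous generators of one of its submodules. The
    generators of one stage are the basis of the free module of the next, up to
    conversion, so that consecutive matrices compose without casts. *)
Record stage := Stage { st_rk : nat; st_deg : 'I_st_rk -> nat; st_gen : gen_mx st_rk }.

Lemma graded_kernel a b (dg : 'I_a -> nat) (dgW : 'I_b -> nat) (W : 'M[S]_(b, a)) :
  (forall r, homog_row dg (dgW r) (row r W)) ->
  graded_submodule dgW (fun v => v *m W = 0).
Proof.
move=> hW; split=> [|D v vW0].
  split=> [|c u v u0 v0]; first by rewrite mul0mx.
  by rewrite mulmxDl -scalemxAl u0 v0 scaler0 addr0.
rewrite -(row_part_mulmx _ _ hW) vW0; apply/rowP => c; rewrite !mxE.
by case: ifP; rewrite ?pihomog0.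
Qed.

(** Choose minimal homogeneous generators of J, then of their syzygies, and so on. The
    rows of each matrix are homogeneous syzygies of the previous generators, so by
    [minimal_gens] their entries have no constant term. *)
Theorem minimal_resolution_exists (J : S -> Prop) :
  J 0 -> (forall c f g, J f -> J g -> J (f + c * g)) ->
  (forall d f, J f -> J (pihomog mdeg d f)) ->
  exists F : free_seq k n, minimal_free_resolution J F.
Proof.
move=> J0 Jlin Jh.
have choose_gens (x : {a & ('I_a -> nat) * ('rV[S]_a -> Prop)}%type) :
    exists G : gen_mx (projT1 x), graded_submodule (projT2 x).1 (projT2 x).2 ->
      minimal_gen_mx (projT2 x).1 (projT2 x).2 G.
  case: x => a [dg M] /=; have [gM|nM] := classic (graded_submodule dg M); last first.
    by exists (@GenMx a 0 (fun=> 0%N) 0).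
  by have [b [dgW [W WP]]] := minimal_gens gM; exists (GenMx dgW W).
have [gen genP] := dep_choice choose_gens.
pose gn a dg M : gen_mx a := gen (existT _ a (dg, M)).
have gnP a dg M : graded_submodule dg M -> minimal_gen_mx dg M (gn a dg M) :=
  genP (existT _ a (dg, M)).
pose st0 := Stage (fun=> 0%N) (gn 1%N (fun=> 0%N) (fun v => J (v 0 0))).
pose next s := Stage (@gm_deg _ (st_gen s))
  (gn _ (@gm_deg _ (st_gen s)) (fun v => v *m gm_mx (st_gen s) = 0)).
pose st := fix st i := if i is j.+1 then next (st j) else st0.
have st0P : minimal_gen_mx (fun=> 0%N) (fun v => J (v 0 0)) (st_gen st0).
  apply: gnP; split=> [|D v Jv]; last by rewrite mxE /=; apply: Jh.
  by split=> [|c u v Ju Jv]; rewrite !mxE //; apply: Jlin.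
have hst i r : homog_row (@st_deg (st i)) (gm_deg r) (row r (gm_mx (st_gen (st i)))).
  elim: i r => [|i IH] r; first exact: st0P.1.1.
  by apply: (gnP _ _ _ _).1.1; apply: graded_kernel IH.
have stP i : minimal_gen_mx (@gm_deg _ (st_gen (st i)))
    (fun v => v *m gm_mx (st_gen (st i)) = 0) (st_gen (st i.+1)).
  by apply: gnP; apply: graded_kernel (hst i).
exists (@FreeSeq k n (fun i => gm_rk (st_gen (st i)))
   (fun i => @gm_deg _ (st_gen (st i))) (fun i => gm_mx (st_gen (st i.+1)))
   (gm_mx (st_gen (st 0)))).
split; first split=> /=.
- move=> r; have := hst 0%N r 0; rewrite mxE => -[->|[d -> //]]; exact: dhomog0.
- by move=> i r c; have := hst i.+1 r c; rewrite mxE.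
- split=> /=.
  + move=> f; have [[_ sP] _] := st0P; have := sP f%:M.
    by rewrite !mxE eqxx mulr1n => ->; split=> -[v]; exists v.
  + exact: (stP 0%N).1.2.
  + by move=> i; apply: (stP i.+1).1.2.
- move=> i r c /=; have [[_ sP] _] := stP i.
  have min_i : minimal_gen_mx (@st_deg (st i)) (row_span (gm_mx (st_gen (st i)))) (st_gen (st i)).
    by case: i {r c sP} => [|i]; [have [[h _] m] := st0P | have [[h _] m] := stP i]; split.
  have := min_i.2 _ _ (hst i.+1 r) _ c; rewrite mxE; apply.
  by apply/sP; apply: row_span_row.
Qed.

End MinimalResolution.

(** * Simplicial chains and acyclicity *)

Section Chains.

Variables (T : finType) (R : comNzRingType).
Implicit Types (t v x : T) (s : {set T}) (z w : {set T} -> R).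

(** The position of v in s fixes the sign of the incidence, for the order given by
    [enum_rank]. *)
Definition before v s := #|[set x in s | (enum_rank x < enum_rank v)%N]|.
Definition sgn v s : R := (-1) ^+ before v s.

(** Chains have a coefficient at every subset of T, the empty one included, and no fixed
    dimension: [bd] is the sum of all the boundary operators of the augmented chain
    complex. *)
Definition bd z s : R := \sum_(v | v \notin s) sgn v s * z (v |: s).

(** Exterior multiplication by t. *)
Definition cone t z s : R := if t \in s then sgn t (s :\ t) * z (s :\ t) else 0.

Lemma sgn_sq v s : sgn v s * sgn v s = 1.
Proof. by rewrite /sgn -expr2 sqrr_sign. Qed.

Lemma sgnU1 v x s : x \notin s ->
  sgn v (x |: s) = (-1) ^+ (enum_rank x < enum_rank v)%N * sgn v s.
Proof.
move=> xs; rewrite /sgn -exprD; congr (_ ^+ _); rewrite /before.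
have [lt_xv|ge_xv] /= := boolP (enum_rank x < enum_rank v)%N.
  have -> : [set y in x |: s | enum_rank y < enum_rank v]%N
      = x |: [set y in s | enum_rank y < enum_rank v]%N.
    by apply/setP => y; rewrite !inE; case: eqVneq => [->|].
  by rewrite cardsU1 inE (negPf xs).
by apply: eq_card => y; rewrite !inE; case: eqVneq => [->|//]; rewrite (negPf ge_xv) !andbF.
Qed.

Lemma sign_swap v x : v != x ->
  (-1) ^+ (enum_rank x < enum_rank v)%N = - (-1) ^+ (enum_rank v < enum_rank x)%N :> R.
Proof.
move=> ne; case: ltngtP => [_|_|/val_inj/enum_rank_inj E]; rewrite ?opprK //.
by rewrite E eqxx in ne.
Qed.

(** The two orders in which a pair of vertices can be removed have opposite signs. *)
Lemma bd_bd z s : bd (bd z) s = 0.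
Proof.
pose F v x := sgn v s * (sgn x (v |: s) * z (x |: (v |: s))).
have -> : bd (bd z) s = \sum_(v | v \notin s) \sum_(x | (x != v) && (x \notin s)) F v x.
  apply: eq_bigr => v vs; rewrite mulr_sumr; apply: eq_bigl => x.
  by rewrite in_setU1 negb_or.
rewrite pair_big_dep /= (bigID (fun p => enum_rank p.1 < enum_rank p.2)%N) /=.
rewrite addrC; apply/eqP; rewrite addr_eq0 -sumrN.
rewrite [X in _ == X](reindex_inj (h := fun p : T * T => (p.2, p.1))) /=; last first.
  by move=> [a b] [c d] [-> ->].
apply/eqP; apply: eq_big => [[v x] /=|[v x] /= /andP[/andP[vs /andP[ne xs]] _]].
  case: (eqVneq x v) => [_|ne] /=; first by rewrite !andbF.
  rewrite -leqNgt leq_eqVlt !val_eqE (inj_eq enum_rank_inj) (negPf ne) /=.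
  by rewrite [(x \notin s) && _]andbC.
rewrite /F !sgnU1 // [(-1) ^+ (_ < _)%N]sign_swap // setUCA.
move: (sgn v s) (sgn x s) (z _) ((-1) ^+ _) => a b c d; ring.
Qed.

(** The cone operator is a contracting homotopy of the full simplex. *)
Lemma bd_cone t z s : bd (cone t z) s = z s - cone t (bd z) s.
Proof.
have [ts|ts] := boolP (t \in s); last first.
  rewrite /bd (bigD1 t) //= big1 => [|v /andP[_ ne]]; last first.
    by rewrite /cone in_setU1 eq_sym (negPf ne) (negPf ts) mulr0.
  by rewrite /cone (negPf ts) setU11 setU1K // mulrA sgn_sq mul1r addr0 subr0.
rewrite /cone ts /bd [X in _ = _ - _ * X](bigD1 t) /=; last by rewrite setD11.
rewrite setD1K // mulrDr mulrA sgn_sq mul1r opprD addNKr mulr_sumr -sumrN.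
apply: eq_big => [v|v vs].
  by rewrite !inE negb_and negbK; case: eqVneq => [->|] /=; rewrite ?ts ?andbT.
have ne : v != t by apply: contraNneq vs => ->.
rewrite in_setU1 ts orbT.
have -> : (v |: s) :\ t = v |: (s :\ t).
  by apply/setP => x; rewrite !inE; case: (eqVneq x v) => [->|//]; rewrite ne.
rewrite -{1}(setD1K ts) !sgnU1 ?inE ?eqxx ?negb_and ?vs ?orbT //.
rewrite [(-1) ^+ (enum_rank t < _)%N]sign_swap //.
have := sqrr_sign R (enum_rank v < enum_rank t)%N; rewrite expr2.
move: (sgn v _) (sgn t _) (z _) ((-1) ^+ _) => a b c d dd.
by transitivity (- (d * d * (b * (a * c)))); [ring | rewrite dd mul1r].
Qed.

Lemma bdB z w s : bd (fun s => z s - w s) s = bd z s - bd w s.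
Proof. by rewrite -sumrB; apply: eq_bigr => v _; rewrite mulrBr. Qed.

Lemma bdD z w s : bd (fun s => z s + w s) s = bd z s + bd w s.
Proof. by rewrite -big_split; apply: eq_bigr => v _; rewrite mulrDr. Qed.

Lemma eq_bd z w : z =1 w -> bd z =1 bd w.
Proof. by move=> E s; apply: eq_bigr => v _; rewrite E. Qed.

Definition supported (K : pred {set T}) z := forall s, ~~ K s -> z s = 0.
Definition down_closed (K : pred {set T}) := forall s s', s \subset s' -> K s' -> K s.

(** Vanishing of the reduced homology, in degree -1 as well: a complex whose only face
    is the empty one is not acyclic. *)
Definition acyclic (K : pred {set T}) : Prop :=
  forall z, supported K z -> bd z =1 (fun=> 0) ->
  exists2 w, supported K w & bd w =1 z.

Lemma acyclic_ext (K K' : pred {set T}) : K =1 K' -> acyclic K -> acyclic K'.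
Proof.
move=> E acK z sz bz; have [|w sw bw] := acK z _ bz.
  by move=> s; rewrite E; apply: sz.
by exists w => // s; rewrite -E; apply: sw.
Qed.

Lemma cone_acyclic (K : pred {set T}) t :
  (forall s, K s -> K (t |: s)) -> acyclic K.
Proof.
move=> Kt z sz bz; exists (cone t z) => [s nK|s]; last first.
  by rewrite bd_cone /cone bz mulr0 if_same subr0.
rewrite /cone; case: ifP => // ts; rewrite sz ?mulr0 //.
by apply: contra nK => /Kt; rewrite setD1K.
Qed.

(** The hypothesis makes the link of v a cone with apex t. If y is the part of the cycle
    z on the faces containing v, then subtracting from z the boundary of the cone over y
    with apex t leaves a cycle on faces that avoid v. *)
Lemma acyclic_cone_vertex (K : pred {set T}) v t :
  down_closed K -> t != v -> (forall s, K s -> v \in s -> K (t |: s)) ->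
  acyclic (fun s => K s && (v \notin s)) -> acyclic K.
Proof.
move=> Kdown ne Kt acD z sz bz.
pose y s := if v \in s then z s else 0.
have bdy s : v \in s -> bd y s = 0.
  by move=> vs; rewrite -[RHS](bz s); apply: eq_bigr => x _; rewrite /y in_setU1 vs orbT.
have [|s|w sw bw] := acD (fun s => z s - bd (cone t y) s).
- move=> s; rewrite bd_cone opprB addrCA => nKv.
  have [vs|vs] := boolP (v \in s).
    rewrite /cone {2}/y vs subrr addr0; case: ifP => // ts.
    by rewrite bdy ?mulr0 // !inE eq_sym ne.
  move: nKv; rewrite vs andbT => nK; rewrite sz // /y (negPf vs) subrr addr0.
  rewrite /cone; case: ifP => // ts; rewrite [bd _ _]big1 ?mulr0 // => x xs.
  case: ifP => [vx|_]; rewrite ?mulr0 //; rewrite sz ?mulr0 //.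
  apply: contra nK => Kx; apply: (Kdown _ (t |: (x |: s :\ t))); last exact: Kt.
  by rewrite setUCA setD1K // subsetUr.
- by rewrite bdB bz bd_bd subrr.
exists (fun s => w s + cone t y s) => [s nK|s]; last by rewrite bdD bw subrK.
rewrite sw ?(negPf nK) // add0r /cone; case: ifP => // ts.
rewrite /y; case: ifP => [vs|_]; rewrite ?mulr0 //; rewrite sz ?mulr0 //.
by apply: contra nK => /Kt/(_ vs); rewrite setD1K.
Qed.

(** No apex is among the deleted vertices, so that every apex is still there when it is
    used. *)
Lemma acyclic_cone_vertices (D : seq T) (K : pred {set T}) :
  down_closed K ->
  (forall v, v \in D -> exists2 t, t \notin D & forall s, K s -> v \in s -> K (t |: s)) ->
  acyclic (fun s => K s && all [pred v | v \notin s] D) -> acyclic K.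
Proof.
elim: D K => [|v D IH] K Kdown apex acD.
  by apply: acyclic_ext acD => s /=; rewrite andbT.
have [t + Kt] := apex v (mem_head v D); rewrite inE negb_or => /andP[ne tD].
apply: (acyclic_cone_vertex Kdown ne Kt); apply: IH.
- move=> s s' ss' /andP[Ks' vs']; rewrite (Kdown _ _ ss') //=.
  by apply: contra vs'; apply: (subsetP ss').
- move=> x xD; have [|u + Ku] := apex x; first by rewrite inE xD orbT.
  rewrite inE negb_or => /andP[neu uD]; exists u => // s /andP[Ks vs] xs.
  by rewrite Ku //= in_setU1 negb_or vs eq_sym neu.
- by apply: acyclic_ext acD => s /=; rewrite andbA.
Qed.

End Chains.

(** * Simplicial free resolutions of monomial ideals *)

Lemma mcoeff_sumX (k : fieldType) n (U : seq 'X_{1..n}) (c : 'X_{1..n} -> k) m : uniq U ->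
  (\sum_(u <- U) c u *: 'X_[u])@_m = if m \in U then c m else 0.
Proof.
move=> uU; rewrite raddf_sum /=; case: ifP => [mU|mU].
  rewrite (bigD1_seq m) //= mcoeffZ mcoeffX eqxx mulr1 big1 ?addr0 // => u ne.
  by rewrite mcoeffZ mcoeffX (negPf ne) mulr0.
rewrite big_seq big1 // => u uU'; rewrite mcoeffZ mcoeffX.
by case: eqP => [E|]; rewrite ?mulr0 //; rewrite E mU in uU'.
Qed.

Lemma mpolyX_inj (k : fieldType) n (m : 'X_{1..n}) : injective (fun p : {mpoly k[n]} => 'X_[m] * p).
Proof.
move=> p q E; apply/mpolyP => u.
by have /(congr1 (mcoeff (m + u)%MM)) := E; rewrite !(mulrC (mpolyX _ m)) !mcoeffMX.
Qed.

Lemma mpolyX_dvd (k : fieldType) n (m : 'X_{1..n}) (p : {mpoly k[n]}) :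
  (forall u, ~~ (m <= u)%MM -> p@_u = 0) -> exists q, p = 'X_[m] * q.
Proof.
move=> p_m; exists (\sum_(u <- msupp p) p@_u *: 'X_[u - m]).
rewrite mulr_sumr {1}[p]mpolyE big_seq [RHS]big_seq; apply: eq_bigr => u.
rewrite mcoeff_msupp => nz; rewrite -scalerAr -mpolyXD addmC submK //.
by apply: contraNT nz => /p_m ->.
Qed.

Lemma mcoeffXM_nle (k : fieldType) n (m u : 'X_{1..n}) (q : {mpoly k[n]}) :
  ~~ (m <= u)%MM -> ('X_[m] * q)@_u = 0.
Proof.
rewrite mulrC => nle; apply: memN_msupp_eq0; rewrite (perm_mem (msuppMX q m)).
by apply: contra nle => /mapP[m' _ ->]; apply: lem_addr.
Qed.

Section Simplicial.

Variables (k : fieldType) (n : nat) (T : finType) (K : pred {set T}).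
Variable (lab : T -> 'X_{1..n}).
Hypothesis Kdown : down_closed K.
Local Notation S := {mpoly k[n]}.
Implicit Types (s : {set T}) (z w : {set T} -> S).

Definition lcm_label s : 'X_{1..n} := [multinom \max_(t in s) lab t j | j < n].

Lemma lcm_labelP s (u : 'X_{1..n}) :
  reflect (forall t, t \in s -> (lab t <= u)%MM) (lcm_label s <= u)%MM.
Proof.
apply: (iffP mnm_lepP) => [le_u t ts|le_u j].
  apply/mnm_lepP => j; apply: leq_trans (le_u j); rewrite mnmE.
  exact: (leq_bigmax_cond (F := fun t => lab t j)).
by rewrite mnmE; apply/bigmax_leqP => t /le_u/mnm_lepP.
Qed.

Lemma lcm_labelS s s' : s \subset s' -> (lcm_label s <= lcm_label s')%MM.
Proof.
move=> ss'; apply/lcm_labelP => t /(subsetP ss') ts'.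
by have /lcm_labelP := lepm_refl (lcm_label s'); apply.
Qed.

Lemma lcm_label1 t : lcm_label [set t] = lab t.
Proof. by apply/mnmP => j; rewrite mnmE big_set1. Qed.

Definition faces i : {set {set T}} := [set s | K s & #|s| == i].

(** The coefficient of s' in the boundary of s. *)
Definition inc s s' : S := \sum_(v | v \notin s') (if v |: s' == s then sgn S v s' else 0).

Lemma bd_inc z s' : bd z s' = \sum_s inc s s' * z s.
Proof.
rewrite /inc; under eq_bigr do rewrite mulr_suml.
rewrite exchange_big; apply: eq_bigr => v _ /=.
rewrite (bigD1 (v |: s')) //= eqxx big1 ?addr0 // => s ne.
by rewrite eq_sym (negPf ne) mul0r.
Qed.

Lemma incU1 v s : v \notin s -> inc (v |: s) s = sgn S v s.
Proof.
move=> vs; rewrite /inc (bigD1 v) //= eqxx big1 ?addr0 // => x /andP[xs ne].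
case: eqP => // /setP/(_ x); rewrite !inE eqxx (negPf ne) (negPf xs) //.
Qed.

Lemma inc_neq0 s s' : inc s s' != 0 -> exists2 v, v \notin s' & s = v |: s'.
Proof.
move=> nz; apply: NNPP => no; case/eqP: nz; rewrite /inc big1 // => v vs.
by case: eqP => // E; case: no; exists v.
Qed.

(** The complex of Bayer, Peeva and Sturmfels: the boundary matrices of K, each entry
    multiplied by the quotient of the labels. *)
Definition simplicial_seq : free_seq k n :=
  @FreeSeq k n (fun i => #|faces i.+1|)
    (fun i r => mdeg (lcm_label (enum_val r)))
    (fun i => \matrix_(r, c) (inc (enum_val r) (enum_val c) *
        'X_[lcm_label (enum_val r) - lcm_label (enum_val c)]))
    (\col_r 'X_[lcm_label (enum_val r)]).

(** Homogenization: the basis vector of the face s is sent to s with the label of s as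
    coefficient. This turns the differentials into the plain boundary of chains with
    polynomial coefficients, and identifies the free module with the chains whose
    coefficient at each s is divisible by the label. *)
Definition chain i (v : 'rV[S]_#|faces i|) s : S :=
  \sum_r (if enum_val r == s then 'X_[lcm_label s] * v 0 r else 0).

Lemma chain_val i (v : 'rV[S]_#|faces i|) r :
  chain v (enum_val r) = 'X_[lcm_label (enum_val r)] * v 0 r.
Proof.
rewrite /chain (bigD1 r) //= eqxx big1 ?addr0 // => c ne.
by rewrite (inj_eq enum_val_inj) (negPf ne).
Qed.

Lemma chain_out i (v : 'rV[S]_#|faces i|) s : s \notin faces i -> chain v s = 0.
Proof.
move=> ns; rewrite /chain big1 // => r _; case: eqP => // E.
by rewrite -E enum_valP in ns.
Qed.

Lemma chain_inj i (v w : 'rV[S]_#|faces i|) : chain v =1 chain w -> v = w.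
Proof.
move=> E; apply/rowP => r; apply: (@mpolyX_inj k n (lcm_label (enum_val r))).
by rewrite -!chain_val E.
Qed.

Lemma chain_mcoeff i (v : 'rV[S]_#|faces i|) s u :
  ~~ (lcm_label s <= u)%MM -> (chain v s)@_u = 0.
Proof.
move=> nle; rewrite raddf_sum big1 // => r _; case: eqP => [_|_]; last by rewrite raddf0.
exact: mcoeffXM_nle.
Qed.

Lemma chain_surj i z : supported (fun s => s \in faces i) z ->
  (forall s u, ~~ (lcm_label s <= u)%MM -> (z s)@_u = 0) ->
  exists v : 'rV[S]_#|faces i|, chain v =1 z.
Proof.
move=> sz zlab; have [q qE] := dep_choice (fun s => mpolyX_dvd (zlab s)).
exists (\row_r q (enum_val r)) => s.
have [sF|sF] := boolP (s \in faces i); last by rewrite chain_out // sz.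
by rewrite -(enum_rankK_in sF sF) chain_val mxE -qE.
Qed.

Lemma sum_chain i (v : 'rV[S]_#|faces i|) (f : {set T} -> S) :
  \sum_s f s * chain v s =
  \sum_r f (enum_val r) * 'X_[lcm_label (enum_val r)] * v 0 r.
Proof.
rewrite (bigID (fun s => s \in faces i)) /= [X in _ + X]big1 ?addr0 => [|s ns]; last first.
  by rewrite chain_out ?mulr0.
by rewrite big_enum_val; apply: eq_bigr => r _; rewrite chain_val mulrA.
Qed.

Lemma face_setU1 i v s : v \notin s -> v |: s \in faces i.+1 -> s \in faces i.
Proof.
move=> vs; rewrite !inE cardsU1 vs eqSS => /andP[Ks ->]; rewrite andbT.
exact: Kdown (subsetUr _ _) Ks.
Qed.

Lemma bd_out i z s : supported (fun s => s \in faces i.+1) z -> s \notin faces i -> bd z s = 0.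
Proof.
move=> sz ns; rewrite /bd big1 // => v vs; rewrite sz ?mulr0 //.
by apply: contra ns; apply: face_setU1.
Qed.

Lemma chain_diff i (v : 'rV[S]_#|faces i.+2|) :
  chain (v *m diff simplicial_seq i) =1 bd (chain v).
Proof.
move=> s; have [sF|sF] := boolP (s \in faces i.+1); last first.
  by rewrite chain_out // (bd_out (i := i.+1)) // => s' /chain_out->.
rewrite -(enum_rankK_in sF sF) chain_val bd_inc sum_chain mxE mulr_sumr.
apply: eq_bigr => r _; rewrite mxE enum_rankK_in //; set s' := enum_val r.
rewrite mulrCA mulrC; congr (_ * _); rewrite mulrCA.
have [->|nz] := eqVneq (inc s' s) 0; first by rewrite !mul0r.
have [x xs ->] := inc_neq0 nz.
by rewrite -mpolyXD addmC submK // lcm_labelS ?subsetUr.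
Qed.

Lemma aug_chain (v : 'rV[S]_#|faces 1|) :
  v *m aug simplicial_seq = (bd (chain v) set0)%:M.
Proof.
apply/matrixP => x y; rewrite !ord1 !mxE eqxx bd_inc sum_chain.
apply: eq_bigr => r _; rewrite mxE mulrC; congr (_ * _).
have := enum_valP r; rewrite inE => /andP[_ /cards1P[t ->]].
rewrite -[X in inc X](setU0) incU1 ?inE // /sgn /before.
rewrite [X in _ ^+ X]eq_card0 ?expr0 ?mul1r // => t'; by rewrite !inE.
Qed.

Lemma mcoeff_bd z s u : (bd z s)@_u = bd (fun s => (z s)@_u) s.
Proof.
rewrite raddf_sum; apply: eq_bigr => v _; rewrite /sgn -signr_odd -[in RHS]signr_odd.
by case: (odd _); rewrite ?mul1r // !mulN1r raddfN.
Qed.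

Hypothesis Kacyclic : forall u, (exists t, K [set t] && (lab t <= u)%MM) ->
  acyclic k (fun s => K s && (lcm_label s <= u)%MM).

(** For each monomial u the coefficients at u of a cycle form a cycle over k on the
    faces whose labels divide u. Bounding chains for the finitely many u that occur are
    cut down to the faces of the right size and reassembled. *)
Lemma cycle_boundary i (v : 'rV[S]_#|faces i.+1|) :
  bd (chain v) =1 (fun=> 0) ->
  exists w : 'rV[S]_#|faces i.+2|, chain v =1 bd (chain w).
Proof.
move=> bv; pose zu u s := (chain v s)@_u.
have szu u s : ~~ ((s \in faces i.+1) && (lcm_label s <= u)%MM) -> zu u s = 0.
  rewrite negb_and => /orP[ns|nle]; last exact: chain_mcoeff.
  by rewrite /zu chain_out ?mcoeff0.
have bzu u : bd (zu u) =1 (fun=> 0) by move=> s; rewrite -mcoeff_bd bv mcoeff0.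
have ex_w u : exists w : {set T} -> k, ((zu u =1 fun=> 0) -> w =1 fun=> 0) /\
    supported (fun s => (s \in faces i.+2) && (lcm_label s <= u)%MM) w /\ bd w =1 zu u.
  have [z0|/not_all_ex_not[s0 /eqP nz]] := classic (zu u =1 fun=> 0).
    by exists (fun=> 0); split=> //; split=> // s; rewrite z0 /bd big1 // => v' _; rewrite mulr0.
  (* A nonzero cycle has a nonempty face, whose vertices lie below u. *)
  have [t Kt] : exists t, K [set t] && (lab t <= u)%MM.
    have /andP[] : (s0 \in faces i.+1) && (lcm_label s0 <= u)%MM.
      by apply: contraNT nz => /szu ->.
    rewrite inE => /andP[Ks0 /eqP s0_card] /lcm_labelP le_u.
    have /set0Pn[t ts] : s0 != set0 by rewrite -cards_eq0 s0_card.
    by exists t; rewrite le_u // (Kdown _ Ks0) // sub1set.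
  have [|//|w sw bw] := Kacyclic (ex_intro _ t Kt) (z := zu u).
    by move=> s; rewrite negb_and => nKs; apply: szu; apply: contraTN nKs;
       rewrite inE => /andP[/andP[-> _] ->].
  exists (fun s => if #|s| == i.+2 then w s else 0); split.
    by move/(_ s0)/eqP; rewrite (negPf nz).
  split=> s; first by rewrite inE andbAC; case: ifP => // _; rewrite andbT => /sw.
  have [s_card|s_card] := eqVneq #|s| i.+1.
    by rewrite -bw; apply: eq_bigr => x xs; rewrite cardsU1 xs s_card eqxx.
  rewrite szu ?inE ?(negPf s_card) ?andbF // /bd big1 // => x xs.
  by rewrite cardsU1 xs eqSS (negPf s_card) mulr0.
have [wu wuP] := dep_choice ex_w.
pose U := undup (flatten [seq msupp (chain v s) | s <- enum {: {set T}}]).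
have UP u : u \notin U -> zu u =1 (fun=> 0).
  rewrite mem_undup => /flattenP nU s; apply: memN_msupp_eq0; apply/negP => us.
  by apply: nU; exists (msupp (chain v s)) => //; apply: map_f; rewrite mem_enum.
pose W s : S := \sum_(u <- U) wu u s *: 'X_[u].
have WE s u : (W s)@_u = wu u s.
  rewrite mcoeff_sumX ?undup_uniq //; case: ifP => // /negbT/UP z0.
  by rewrite (wuP u).1.
have [|s u nle|w wE] := @chain_surj i.+2 W.
- by move=> s ns; apply/mpolyP => u; rewrite WE mcoeff0 (wuP u).2.1 // negb_and ns.
- by rewrite WE (wuP u).2.1 // negb_and nle orbT.
exists w => s; rewrite (eq_bd wE); apply/mpolyP => u.
by rewrite mcoeff_bd (eq_bd (fun s => WE s u)) (wuP u).2.2.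
Qed.

Theorem simplicial_resolves (J : S -> Prop) :
  (forall f, J f <-> exists c : T -> S, f = \sum_(t | K [set t]) c t * 'X_[lab t]) ->
  resolves J simplicial_seq.
Proof.
move=> JP; split.
- move=> f; split=> [/JP[c ->]|[v vE]].
    exists (\row_r \sum_(t | [set t] == enum_val r) c t); apply/matrixP => x y.
    rewrite !ord1 !mxE eqxx mulr1n.
    transitivity (\sum_(s in faces 1) \sum_(t | [set t] == s) c t * 'X_[lab t]).
      rewrite [RHS]big_enum_val; apply: eq_bigr => r _; rewrite !mxE mulr_suml.
      by apply: eq_bigr => t /eqP <-; rewrite lcm_label1.
    rewrite (exchange_big_dep predT) //= [RHS]big_mkcond; apply: eq_bigr => t _.
    case: ifP => Kt; last first.
      rewrite big_pred0 // => s; apply: contraFF Kt.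
      by rewrite inE => /andP[/andP[Ks _] /eqP->].
    rewrite (bigD1 [set t]) ?inE ?Kt ?cards1 ?eqxx //= big1 ?addr0 // => s.
    by move=> /andP[/andP[_ /eqP->]]; rewrite eqxx.
  apply/JP; have {vE} := congr1 (fun M : 'M_1 => M 0 0) vE; rewrite [RHS]mxE eqxx mulr1n => <-.
  pose c t := \sum_r (if enum_val r == [set t] then v 0 r else 0).
  exists c; rewrite mxE; under [RHS]eq_bigr do rewrite mulr_suml.
  rewrite exchange_big; apply: eq_bigr => r _ /=; rewrite mxE.
  have := enum_valP r; rewrite inE => /andP[Kr /cards1P[t rE]].
  rewrite (bigD1 t) -?rE //= eqxx big1 ?addr0 ?rE ?lcm_label1 // => t' /andP[_ ne].
  by case: eqP => [/set1_inj E|_]; rewrite ?mul0r //; rewrite E eqxx in ne.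
- move=> v; split=> [v0|[w ->]]; last first.
    rewrite aug_chain (eq_bd (chain_diff w)) bd_bd.
    by apply/matrixP => x y; rewrite !mxE mul0rn.
  have [s|w wE] := @cycle_boundary 0 v; last first.
    by exists w; apply: chain_inj => s; rewrite chain_diff wE.
  have [->|nz] := eqVneq s set0.
    by move: v0; rewrite aug_chain => /matrixP/(_ 0 0); rewrite !mxE eqxx.
  apply: (bd_out (i := 0)) => [s' /chain_out-> //|].
  by rewrite inE cards_eq0 (negPf nz) andbF.
- move=> i v; split=> [v0|[w ->]]; last first.
    apply: (@chain_inj i.+1) => s; rewrite chain_diff (eq_bd (chain_diff w)) bd_bd.
    by rewrite /chain big1 // => r _; rewrite mxE mulr0 if_same.
  have [s|w wE] := @cycle_boundary i.+1 v; last first.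
    by exists w; apply: chain_inj => s; rewrite chain_diff wE.
  by rewrite -chain_diff v0 /chain big1 // => r _; rewrite mxE mulr0 if_same.
Qed.

(** A nonzero entry is, up to sign, a quotient of the labels of a face and of a facet of
    it, which is a nonconstant monomial when the labels differ. *)
Lemma simplicial_minimal :
  (forall s v, K s -> v \in s -> lcm_label (s :\ v) != lcm_label s) ->
  minimal_seq simplicial_seq.
Proof.
move=> min_lab i r c /=; rewrite mxE.
have [->|nz] := eqVneq (inc (enum_val r) (enum_val c)) 0.
  by rewrite mul0r mcoeff0.
have [v vs rE] := inc_neq0 nz; rewrite rE incU1 // /sgn -signr_odd.
have Kr : K (v |: enum_val c) by rewrite -rE; have := enum_valP r; rewrite inE => /andP[].
have := min_lab _ v Kr (setU11 _ _); rewrite setU1K // => ne.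
suff X0 : ('X_[lcm_label (v |: enum_val c) - lcm_label (enum_val c)] : S)@_0%MM = 0.
  by case: (odd _); rewrite ?mulN1r ?mul1r ?mcoeffN X0 ?oppr0.
rewrite mcoeffX; case: eqP => // E; case/eqP: ne.
have := submK (lcm_labelS (subsetUr [set v] (enum_val c))).
by rewrite E add0m.
Qed.

End Simplicial.

(** * The Scarf complex of the third power *)

Section ScarfComplex.

Local Open Scope nat_scope.

Variable q : nat.
Implicit Types (i j k l a b : 'I_q) (A B X Y : {set 'I_q}).

(** [inl (i, j)] stands for 2e_i + e_j, and so [inl (i, i)] for 3e_i; [inr X] stands
    for the sum of the e_a over a in X, and is a vertex of the complex only when X has
    three elements. *)
Definition vert : finType := ('I_q * 'I_q + {set 'I_q})%type.
Implicit Types (x y v : vert) (s : {set vert}).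

Definition pr i j : vert := inl (i, j).
Definition tr X : vert := inr X.

(** The value a(A) for the vector a indexed by the vertex: the exponent of x_A in the
    product of generators of E_q. *)
Definition wt x A : nat :=
  match x with
  | inl (i, j) => 2 * (i \in A) + (j \in A)
  | inr X => #|X :&: A|
  end.

(** Two vertices are incompatible when the label of a suitable third one divides the lcm
    of their labels: for 2e_i + e_j and a triple {j, b, c} without i, for instance,
    that of e_i + e_j + e_b. *)
Definition compat x y : bool :=
  match x, y with
  | inl (i, j), inl (k, l) => (i == k) || ((i == l) && (j == k))
  | inl (i, j), inr X | inr X, inl (i, j) => (i != j) && ((i \in X) || (j \notin X))
  | inr X, inr Y => (#|X| == 3) && (#|Y| == 3)
  end.

(** Up to one exception the complex is the clique complex of [compat]. The exception is
    that 2e_i + e_j, 2e_j + e_i and a triple disjoint from {i, j} do not span a face. *)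
Definition scarf s : bool :=
  [forall x in s, forall y in s, compat x y] &&
  [forall i, forall j, forall X,
    [&& pr i j \in s, pr j i \in s & tr X \in s] ==> (i \in X)].

Lemma scarfP s : reflect
  ({in s &, forall x y, compat x y} /\
   forall i j X, pr i j \in s -> pr j i \in s -> tr X \in s -> i \in X)
  (scarf s).
Proof.
apply: (iffP andP) => -[compat_s tri_s]; split.
- by move=> x y xs ys; have /forall_inP/(_ _ xs)/forall_inP/(_ _ ys) := compat_s.
- move=> i j X ij_s ji_s X_s.
  by have /forallP/(_ i)/forallP/(_ j)/forallP/(_ X)/implyP := tri_s; rewrite ij_s ji_s X_s; apply.
- by apply/forall_inP => x xs; apply/forall_inP => y; apply: compat_s.
- apply/forallP => i; apply/forallP => j; apply/forallP => X; apply/implyP => /and3P[].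
  exact: tri_s.
Qed.

Lemma scarf_down : down_closed scarf.
Proof.
move=> s s' /subsetP ss' /scarfP[c t]; apply/scarfP; split=> [x y xs ys|i j X xs ys Xs].
  by apply: c; apply: ss'.
by apply: (t i j); apply: ss'.
Qed.

Lemma compat_sym x y : compat x y = compat y x.
Proof.
case: x y => [[i j]|X] [[k l]|Y] //=; last exact: andbC.
by rewrite [k == i]eq_sym [k == j]eq_sym [l == i]eq_sym [(_ == _) && (j == k)]andbC.
Qed.

Lemma card_set1I A a : #|[set a] :&: A| = (a \in A).
Proof.
have [aA|aA] := boolP (a \in A); first by rewrite (setIidPl _) ?cards1 ?sub1set.
by apply/eqP; rewrite cards_eq0 setI_eq0 disjoints1.
Qed.

Lemma card_setI_lb1 X A a : a \in X -> (a \in A) <= #|X :&: A|.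
Proof.
move=> aX; case: (boolP (a \in A)) => // aA; rewrite card_gt0; apply/set0Pn.
by exists a; rewrite inE aX.
Qed.

Lemma card_setI_lb2 X A a b : a != b -> a \in X -> b \in X ->
  (a \in A) + (b \in A) <= #|X :&: A|.
Proof.
move=> ne aX bX.
have : #|[set a; b] :&: A| <= #|X :&: A|.
  by apply/subset_leq_card/setSI/subsetP => c; rewrite !inE => /orP[/eqP->|/eqP->].
apply: leq_trans; rewrite setIUl cardsU.
have -> : [set a] :&: A :&: ([set b] :&: A) = set0.
  by apply/setP => c; rewrite !inE; case: eqVneq => //= ->; rewrite (negPf ne) andbF.
by rewrite !card_set1I cards0 subn0.
Qed.

Lemma card_setI_ub3 A a b c :
  #|[set a; b; c] :&: A| <= (a \in A) + (b \in A) + (c \in A).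
Proof.
rewrite !setIUl; apply: leq_trans (leq_card_setU _ _) _; rewrite card_set1I leq_add2r.
by apply: leq_trans (leq_card_setU _ _) _; rewrite !card_set1I.
Qed.

Lemma cards3 a b c : a != b -> a != c -> b != c -> #|[set a; b; c]| = 3.
Proof.
by move=> ab ac bc; rewrite setUC cardsU1 cards2 !inE ab eq_sym (negPf ac) eq_sym (negPf bc).
Qed.

Section LcmClosed.

(** The vertices whose labels divide a fixed monomial, seen only through the closure
    property that follows. *)
Variable ok : pred vert.
Hypothesis ok_closed : forall (xs : seq vert) y, all ok xs ->
  (forall A, wt y A <= \max_(x <- xs) wt x A) -> ok y.

Lemma ok_closed2 x y z : ok x -> ok y ->
  (forall A, wt z A <= maxn (wt x A) (wt y A)) -> ok z.
Proof.
move=> okx oky le_z; apply: (@ok_closed [:: x; y]) => [|A]; first by rewrite /= okx oky.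
by rewrite !big_cons big_nil maxn0.
Qed.

(** Here and in the next lemmas, the weights on A are compared through the membership in
    A of the few indices involved. *)
Lemma ok_cube i x : ok (pr i i) -> ok x -> compat x x -> x != pr i i ->
  exists2 j, j != i & ok (pr i j).
Proof.
move=> oki okx; case: x okx => [[k l]|X] okx /= cx.
  case: (eqVneq k i) okx => [->|ne] okx.
    by move=> ne; exists l => //; apply: contraNneq ne => ->.
  move=> _; exists k => //; apply: ok_closed2 oki okx _ => A /=.
  by case: (i \in A); case: (k \in A); case: (l \in A).
move=> _; have /set0Pn[j] : X :\ i != set0.
  move: cx; rewrite andbb -card_gt0 => /eqP cX.
  by rewrite -(ltn_add2l (i \in X)) -cardsD1 cX; case: (i \in X).
rewrite !inE => /andP[ji jX]; exists j => //.
apply: ok_closed2 oki okx _ => A /=; have := card_setI_lb1 A jX.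
by case: (i \in A); case: (j \in A) => /=; lia.
Qed.

Lemma ok_pr_pr i j k l : i != j -> i != k -> j != k -> ok (pr i j) -> ok (pr k l) ->
  ok (tr [set i; j; k]).
Proof.
move=> ij ik jk okij okkl; apply: ok_closed2 okij okkl _ => A.
apply: leq_trans (card_setI_ub3 _ _ _ _) _ => /=.
by case: (i \in A); case: (j \in A); case: (k \in A); case: (l \in A).
Qed.

Lemma ok_pr_tr i j b X : ok (pr i j) -> ok (tr X) -> j \in X -> b \in X ->
  b != j -> ok (tr [set i; j; b]).
Proof.
move=> okij okX jX bX bj; apply: ok_closed2 okij okX _ => A.
apply: leq_trans (card_setI_ub3 _ _ _ _) _ => /=.
have := card_setI_lb2 A bj bX jX.
by case: (i \in A); case: (j \in A); case: (b \in A) => /=; lia.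
Qed.

(** The reason for the exception in [scarf]: for each a in the triple, e_i + e_j + e_a
    divides the lcm of the three labels. *)
Lemma ok_pr_pr_tr i j a X : ok (pr i j) -> ok (pr j i) -> ok (tr X) -> a \in X ->
  ok (tr [set i; j; a]).
Proof.
move=> okij okji okX aX; apply: (@ok_closed [:: pr i j; pr j i; tr X]) => [|A].
  by rewrite /= okij okji okX.
apply: leq_trans (card_setI_ub3 _ _ _ _) _; rewrite !big_cons big_nil /=.
have := card_setI_lb1 A aX.
by case: (i \in A); case: (j \in A); case: (a \in A) => /=; lia.
Qed.


Definition is_cube x := if x is inl (i, j) then i == j else false.
Definition is_pair x := if x is inl _ then true else false.

Definition okv x := compat x x && ok x.

Lemma compat_pr i j k l : compat (pr i j) (pr k l) = (i == k) || ((i == l) && (j == k)).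
Proof. by []. Qed.

Lemma compat_pr_tr i j X : compat (pr i j) (tr X) = (i != j) && ((i \in X) || (j \notin X)).
Proof. by []. Qed.

Lemma okv_tr X : okv (tr X) = (#|X| == 3) && ok (tr X).
Proof. by rewrite /okv /= andbb. Qed.

Lemma okv_pr i j : okv (pr i j) = ok (pr i j).
Proof. by rewrite /okv /= eqxx. Qed.

Lemma ok_tr3 a b c : ok (tr [set a; b; c]) -> a != b -> a != c -> b != c ->
  okv (tr [set a; b; c]).
Proof. by move=> oka ab ac bc; rewrite okv_tr cards3. Qed.

(** A triple that can be added to every face containing [pr i j]. The second disjunction
    covers the faces that also contain 2e_j + e_i. *)
Definition apex_triple i j X : bool :=
  [&& okv (tr X), i \in X & (j \in X) || ~~ ok (pr j i)].

(** Without an apex for 2e_i + e_j the closure of [ok] leaves little: if 2e_j + e_i is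
    in [ok], these two are the only vertices besides the 3e_a; otherwise the others are
    some 2e_i + e_b and triples that avoid i and every such b. Both sets span a
    simplex. *)
Lemma scarf_no_apex i j : i != j -> ok (pr i j) -> (forall X, ~~ apex_triple i j X) ->
  forall s, {in s, forall x, okv x && ~~ is_cube x} -> scarf s.
Proof.
move=> ij okij noX s s_ok.
have s_pr a b : pr a b \in s -> ok (pr a b) /\ a != b.
  by move=> /s_ok /=; rewrite okv_pr => /andP[].
have s_tr X : tr X \in s -> #|X| = 3 /\ ok (tr X).
  by move=> /s_ok /=; rewrite okv_tr andbT => /andP[/eqP].
have no3 a b c : ok (tr [set a; b; c]) -> a != b -> a != c -> b != c ->
    i \in [set a; b; c] -> (j \in [set a; b; c]) || ~~ ok (pr j i) -> False.
  move=> ok3 ab ac bc i3 j3; have /negP := noX [set a; b; c]; apply.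
  by rewrite /apex_triple ok_tr3 // i3.
have ji : j != i by rewrite eq_sym.
have [okji|nji] := boolP (ok (pr j i)).
  have only a b : pr a b \in s -> (a == i) && (b == j) || (a == j) && (b == i).
    move=> /s_pr[okab ab].
    have [ai|ai] := eqVneq a i.
      have [//|bj] := eqVneq b j; exfalso; rewrite ai in okab ab.
      by apply: (no3 i b j (ok_pr_pr ab ij bj okab okji)); rewrite ?inE ?eqxx ?orbT.
    have [aj|aj] := eqVneq a j.
      have [//|bi] := eqVneq b i; exfalso; rewrite aj in okab ab.
      by apply: (no3 j b i (ok_pr_pr ab ji bi okab okij)); rewrite ?inE ?eqxx ?orbT.
    exfalso; have ia : i != a by rewrite eq_sym.
    have ja : j != a by rewrite eq_sym.
    by apply: (no3 i j a (ok_pr_pr ij ia ja okij okab)); rewrite ?inE ?eqxx ?orbT.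
  have none X : tr X \in s -> False.
    move=> /s_tr[X3 okX].
    have /subsetPn[a aX] : ~~ (X \subset [set i; j]).
      by apply/negP => /subset_leq_card; rewrite X3 cards2 ij.
    rewrite !inE negb_or => /andP[ai aj].
    apply: (no3 i j a (ok_pr_pr_tr okij okji okX aX)); rewrite ?inE ?eqxx ?orbT //.
      by rewrite eq_sym.
    by rewrite eq_sym.
  apply/scarfP; split=> [x y xs ys|a b X _ _ /none //].
  case: x xs => [[a b] /only abE|X /none //]; case: y ys => [[c d] /only cdE|X /none //].
  by case/orP: abE => /andP[/eqP-> /eqP->]; case/orP: cdE => /andP[/eqP-> /eqP->];
     rewrite /= !eqxx ?orbT.
have only a b : pr a b \in s -> a = i.
  move=> /s_pr[okab ab]; have [//|ai] := eqVneq a i; exfalso.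
  have ia : i != a by rewrite eq_sym.
  have [ja|ja] := eqVneq j a.
    have bi : b != i by apply: contraNneq nji => bi; rewrite ja -bi.
    have aj : a != i by rewrite -ja.
    by apply: (no3 a b i (ok_pr_pr ab ai bi okab okij)); rewrite ?inE ?ja ?eqxx ?orbT ?nji.
  by apply: (no3 i j a (ok_pr_pr ij ia ja okij okab)); rewrite ?inE ?eqxx ?orbT ?nji.
have noi X : tr X \in s -> i \notin X.
  move=> /s_tr[X3 okX]; apply/negP => iX; have /negP := noX X; apply.
  by rewrite /apex_triple okv_tr X3 okX iX nji orbT.
have cpt a b X : pr a b \in s -> tr X \in s -> compat (pr a b) (tr X).
  move=> abs Xs; have [okab ab] := s_pr _ _ abs; have iX := noi _ Xs.
  have ai := only _ _ abs; subst a; rewrite compat_pr_tr ab (negPf iX) /=.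
  apply/negP => bX; have [X3 okX] := s_tr _ Xs.
  have /subsetPn[c cX] : ~~ (X \subset [set b]).
    by apply/negP => /subset_leq_card; rewrite X3 cards1.
  rewrite inE => cb; have ci : i != c by apply: contraNneq iX => ->.
  have bc : b != c by rewrite eq_sym.
  by apply: (no3 i b c (ok_pr_tr okab okX bX cX cb)); rewrite ?inE ?eqxx ?orbT ?nji ?orbT.
apply/scarfP; split=> [x y xs ys|a b X abs bas _].
  case: x xs => [[a b]|X] xs; case: y ys => [[c d]|Y] ys.
  - by rewrite compat_pr (only _ _ xs) (only _ _ ys) eqxx.
  - exact: cpt.
  - by rewrite compat_sym; apply: cpt.
  - by rewrite /= (s_tr _ xs).1 (s_tr _ ys).1.
by have [_] := s_pr _ _ abs; rewrite (only _ _ abs) (only _ _ bas) eqxx.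
Qed.

Definition ok_scarf s := scarf s && [forall x in s, ok x].

Lemma ok_scarf_okv s x : ok_scarf s -> x \in s -> okv x.
Proof.
move=> /andP[/scarfP[c _] /forall_inP oks] xs; apply/andP; split; last exact: oks.
exact: c.
Qed.

Lemma ok_scarfU1 s x : ok_scarf s -> ok x -> scarf (x |: s) -> ok_scarf (x |: s).
Proof.
move=> /andP[_ /forall_inP oks] okx Kxs; apply/andP; split=> //.
by apply/forall_inP => y; rewrite in_setU1 => /predU1P[-> //|/oks].
Qed.

Lemma scarfU1 s x : scarf s -> compat x x -> (forall y, y \in s -> compat x y) ->
  (forall i j X, pr i j \in x |: s -> pr j i \in x |: s -> tr X \in x |: s -> i \in X) ->
  scarf (x |: s).
Proof.
move=> /scarfP[c _] cx cxs tri; apply/scarfP; split=> // y z.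
rewrite !in_setU1 => /predU1P[->|ys] /predU1P[->|zs] //; last exact: c.
  exact: cxs.
by rewrite compat_sym; apply: cxs.
Qed.

Lemma cube_apex i j s : i != j -> ok (pr i j) -> ok_scarf s -> pr i i \in s ->
  ok_scarf (pr i j |: s).
Proof.
move=> ij okij Ks iis; apply: ok_scarfU1 => //; have /andP[Ks' _] := Ks.
have /scarfP[c _] := Ks'.
have notr X : tr X \notin s.
  by apply/negP => /(c _ _ iis); rewrite compat_pr_tr eqxx.
apply: scarfU1 => //=; first by rewrite eqxx.
  move=> [[k l]|X] ys; last by rewrite (negPf (notr X)) in ys.
  have /= := c _ _ iis ys; case: eqVneq => //= ik; rewrite andbF.
  by [].
by move=> a b X _ _; rewrite in_setU1 (negPf (notr X)).
Qed.

Lemma pair_apex i j X s : i != j -> apex_triple i j X ->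
  ok_scarf s -> {in s, forall x, ~~ is_cube x} -> pr i j \in s ->
  ok_scarf (tr X |: s).
Proof.
move=> ij /and3P[]; rewrite okv_tr => /andP[X3 okX] iX jX Ks nocube ijs.
have /andP[Ks' _] := Ks; have /scarfP[c tri] := Ks'.
have fst a b : pr a b \in s -> a \in X.
  move=> abs; have := c _ _ ijs abs; rewrite compat_pr => /orP[/eqP<- //|/andP[/eqP ib /eqP ja]].
  have := ok_scarf_okv Ks abs; rewrite okv_pr -ja -ib => okji.
  by move: jX; rewrite okji orbF.
apply: ok_scarfU1 => //; apply: scarfU1 => //=; first by rewrite andbb.
  move=> [[k l]|Y] ys.
    by have := nocube _ ys; rewrite /= (fst _ _ ys) => ->.
  by have := ok_scarf_okv Ks ys; rewrite okv_tr X3 => /andP[->].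
move=> a b Y; rewrite !in_setU1 /= => abs bas.
by move=> /predU1P[[->]|]; [apply: fst abs | apply: (tri a b)].
Qed.

Lemma ok_scarf_down : down_closed ok_scarf.
Proof.
move=> s s' ss' /andP[Ks /forall_inP oks]; rewrite /ok_scarf (scarf_down ss') //=.
by apply/forall_inP => x /(subsetP ss'); apply: oks.
Qed.

Lemma down_closed_avoid (K : pred {set vert}) (D : seq vert) :
  down_closed K -> down_closed (fun s => K s && all [pred v | v \notin s] D).
Proof.
move=> Kd s s' ss' /andP[Ks' /allP as']; rewrite (Kd _ _ ss') //=.
by apply/allP => v /as' /=; apply: contra; apply: (subsetP ss').
Qed.

(** If 3e_i is not the only vertex, some 2e_i + e_j is an apex for it, so all the 3
    e_i can be deleted. Then either the remaining vertices span a simplex, or every 2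
    e_i + e_j has a triple as apex and can be deleted too, which leaves a simplex of
    triples. *)
Theorem ok_scarf_acyclic (R : comNzRingType) : (exists x, okv x) -> acyclic R ok_scarf.
Proof.
move=> [x0 okx0].
have cubeE x : is_cube x -> exists i, x = pr i i.
  by case: x => [[i j] /= /eqP->|//]; exists j.
have [[i [oki only_i]]|not_one] :=
  classic (exists i, ok (pr i i) /\ forall x, okv x -> x = pr i i).
  apply: (cone_acyclic (t := pr i i)) => s Ks.
  apply: ok_scarfU1 => //; apply: scarfU1 => //=; first by have /andP[] := Ks.
  - by rewrite eqxx.
  - by move=> y /(ok_scarf_okv Ks)/only_i ->; rewrite /= eqxx.
  - move=> a b X _ _; rewrite in_setU1 => /predU1P[//|/(ok_scarf_okv Ks)/only_i].
    by [].
have cube_pair i : ok (pr i i) -> exists2 j, i != j & ok (pr i j).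
  move=> oki; have [x [okx ne]] : exists x, okv x /\ x <> pr i i.
    apply: NNPP => no; apply: not_one; exists i; split=> // x okx.
    by apply: NNPP => ne; apply: no; exists x.
  have /andP[cx okx'] := okx.
  have [|j ji okj] := ok_cube oki okx' cx; first exact/eqP.
  by exists j; rewrite // eq_sym.
have [x1 okx1 nc1] : exists2 x, okv x & ~~ is_cube x.
  have [/cubeE[i x0E]|nc0] := boolP (is_cube x0); last by exists x0.
  have [|j ij okj] := cube_pair i; first by rewrite -okv_pr -x0E.
  by exists (pr i j); rewrite ?okv_pr.
(* Vertices outside ok are deleted vacuously, with an arbitrary vertex of the other kind as apex. *)
pose cubes := [seq x <- enum {: vert} | is_cube x].
have memc x : (x \in cubes) = is_cube x by rewrite mem_filter mem_enum andbT.
apply: (acyclic_cone_vertices (D := cubes) ok_scarf_down) => [v|].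
  rewrite memc => /cubeE[i ->]; have [oki|nok] := boolP (ok (pr i i)).
    have [j ij okj] := cube_pair i oki; exists (pr i j); first by rewrite memc.
    by move=> s; apply: cube_apex.
  exists (tr set0) => [|s Ks /(ok_scarf_okv Ks)]; first by rewrite memc.
  by rewrite okv_pr (negPf nok).
set K1 := fun s => _ && _.
have K1P s : K1 s -> ok_scarf s /\ {in s, forall x, ~~ is_cube x}.
  move=> /andP[Ks /allP nc]; split=> // x xs; apply/negP; rewrite -memc => /nc /=.
  by rewrite xs.
have K1I s : ok_scarf s -> {in s, forall x, ~~ is_cube x} -> K1 s.
  move=> Ks nc; apply/andP; split=> //; apply/allP => x; rewrite memc /= => cx.
  by apply: contraL cx; apply: nc.
have [[i [j [ij okij noX]]]|apexes] := classic (exists i j,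
    [/\ i != j, ok (pr i j) & forall X, ~~ apex_triple i j X]).
  apply: (cone_acyclic (t := x1)) => s /K1P[Ks nc]; have /andP[_ okx1'] := okx1.
  apply: K1I => [|x]; last by rewrite in_setU1 => /predU1P[->|/nc].
  apply: ok_scarfU1 => //; apply: (scarf_no_apex ij okij noX) => x.
  rewrite in_setU1 => /predU1P[->|xs]; first by rewrite okx1.
  by rewrite (ok_scarf_okv Ks xs) nc.
have pair_triple i j : i != j -> ok (pr i j) -> exists X, apex_triple i j X.
  move=> ij okij; apply: NNPP => no; apply: apexes; exists i, j; split=> // X.
  by apply/negP => aX; apply: no; exists X.
pose pairs := [seq x <- enum {: vert} | is_pair x].
have memp x : (x \in pairs) = is_pair x by rewrite mem_filter mem_enum andbT.
have [X okX] : exists X, okv (tr X).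
  case: x1 okx1 nc1 => [[i j]|X] okx1 nc1; last by exists X.
  have [|X /andP[]] := pair_triple i j nc1; first by rewrite -okv_pr.
  by exists X.
apply: (acyclic_cone_vertices (D := pairs)) => [|v|].
- exact: (down_closed_avoid ok_scarf_down).
- rewrite memp; case: v => // -[i j] _.
  have [/andP[okij ij]|nok] := boolP (ok (pr i j) && (i != j)).
    have [Y aY] := pair_triple i j ij okij; exists (tr Y); first by rewrite memp.
    move=> s /K1P[Ks nc] ijs; apply: K1I => [|x]; last first.
      by rewrite in_setU1 => /predU1P[->|/nc].
    exact: pair_apex ij aY Ks nc ijs.
  exists (tr set0) => [|s /K1P[Ks nc] ijs]; first by rewrite memp.
  have := ok_scarf_okv Ks ijs; rewrite okv_pr => okij.
  by move: nok; rewrite okij /=; have /= := nc _ ijs => ->.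
apply: (cone_acyclic (t := tr X)) => s /andP[/K1P[Ks nc] /allP np].
have trs x : x \in s -> exists Y, x = tr Y.
  case: x => [p ps|Y _]; last by exists Y.
  by have := np (inl p); rewrite memp /= ps => /(_ isT).
apply/andP; split; last first.
  apply/allP => x xp; have xs : x \notin s := np _ xp.
  by rewrite /= in_setU1 negb_or xs andbT; apply: contraTneq xp => ->; rewrite memp.
apply: K1I => [|x]; last by rewrite in_setU1 => /predU1P[->|/nc].
have X3 : #|X| == 3 by move: okX; rewrite okv_tr => /andP[].
apply: ok_scarfU1 => //; first by move: okX; rewrite okv_tr => /andP[].
apply: scarfU1 => //=; first by have /andP[] := Ks.
- by rewrite X3.
- move=> y ys; have [Y yE] := trs _ ys; have := ok_scarf_okv Ks ys.
  by rewrite yE okv_tr /= X3 => /andP[->].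
- by move=> a b Y; rewrite in_setU1 => /predU1P[//|/trs[]].
Qed.

End LcmClosed.

Lemma triple_subset X Y : #|X| = 3 -> #|Y| = 3 -> X \subset Y -> X = Y.
Proof. by move=> X3 Y3 XY; apply/eqP; rewrite eqEcard XY X3 Y3. Qed.

(** The Scarf property. For v = 3e_i the set A is {i}. If v = 2e_i + e_j with i
    distinct from j, the set A is {j}, {i} or {i, j} according to whether the face
    contains 3e_i, or 2e_j + e_i, or neither. If v is a triple X, then A is X minus
    {i, j} when the face contains 2e_i + e_j and 2e_j + e_i; X minus i when it
    contains some 2e_i + e_j with i, j in X; and X otherwise. *)
Lemma scarf_strict s v : scarf s -> v \in s ->
  exists A, forall x, x \in s -> x != v -> wt x A < wt v A.
Proof.
move=> /scarfP[c tri] vs; have cv x : x \in s -> compat v x by apply: c.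
have card_le X A : #|X :&: A| <= #|A| by rewrite subset_leq_card ?subsetIr.
case: v vs cv => [[i j]|X] vs cv.
  have [ij|ij] := eqVneq i j.
    subst j; exists [set i] => -[[k l]|Y] xs ne; last by have := cv _ xs; rewrite /= eqxx.
    have /= := cv _ xs; case: (eqVneq i k) => [ik|ik] /=; last by rewrite andbF.
    subst k => _; have li : l != i by apply: contraNneq ne => ->.
    by rewrite !inE eqxx (negPf li).
  have [iis|niis] := boolP (pr i i \in s).
    exists [set j] => -[[k l]|Y] xs ne; last by have := c _ _ iis xs; rewrite /= eqxx.
    have := c _ _ iis xs; rewrite /=; case: (eqVneq i k) => [ik|ik] /=; last by rewrite andbF.
    subst k => _; have lj : l != j by apply: contraNneq ne => ->.
    by rewrite !inE eqxx (negPf ij) (negPf lj).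
  have [jis|njis] := boolP (pr j i \in s).
    exists [set i] => -[[k l]|Y] xs ne; last first.
      apply: leq_ltn_trans (card_le _ _) _; rewrite cards1 /= !inE eqxx.
      by rewrite mul2n.
    have [ki|ki] := eqVneq k i.
      subst k; have := c _ _ jis xs; rewrite /= [j == i]eq_sym (negPf ij) /= => /andP[jl _].
      by rewrite eq_sym (eqP jl) eqxx in ne.
    rewrite /= !inE eqxx (negPf ki) [j == i]eq_sym (negPf ij) /=; case: (l == i) => //.
  exists [set i; j] => -[[k l]|Y] xs ne; last first.
    by apply: leq_ltn_trans (card_le _ _) _; rewrite cards2 ij /= !inE !eqxx orbT.
  have := cv _ xs; rewrite /=; have [ik|ik] := eqVneq i k => /=.
    subst k => _; have lj : l != j by apply: contraNneq ne => ->.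
    have li : l != i by apply: contraNneq niis => E; rewrite -{2}E.
    by rewrite !inE !eqxx (negPf li) (negPf lj) orbT.
  by move=> /andP[/eqP il /eqP jk]; subst k l; rewrite xs in njis.
have X3 : #|X| = 3 by have /andP[/eqP] := cv _ vs.
have triples Y : tr Y \in s -> #|Y| = 3 by move=> /cv /andP[_ /eqP].
have no_cube k l : pr k l \in s -> (k != l) && ((k \in X) || (l \notin X)).
  by move=> /cv.
have [[i [j [ijs jis]]]|nosym] := classic (exists i j, pr i j \in s /\ pr j i \in s).
  have /andP[ij _] := no_cube _ _ ijs.
  have Yij Y : tr Y \in s -> [set i; j] \subset Y.
    move=> Ys; apply/subsetP => a; rewrite !inE => /orP[/eqP->|/eqP->].
      exact: (tri i j).
    exact: (tri j i).
  have wX : #|X :&: (X :\: [set i; j])| = 1.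
    by rewrite (setIidPr (subsetDl _ _)) cardsD (setIidPr (Yij _ vs)) X3 cards2 ij.
  exists (X :\: [set i; j]) => x xs ne; rewrite [wt (inr X) _]wX.
  case: x xs ne => [[k l]|Y] xs ne.
    have kl : (k \in [set i; j]) && (l \in [set i; j]).
      have := c _ _ ijs xs; have := c _ _ jis xs; rewrite /= !inE.
      have /andP[nkl _] := no_cube _ _ xs.
      by do 4! case: eqP => ? //=; subst; rewrite ?eqxx ?orbT // in ij nkl *.
    case/andP: kl => kij lij; by rewrite /= !in_setD kij lij.
  rewrite ltnS leqn0 cards_eq0 /=; apply/eqP/setP => a; rewrite !inE.
  apply/negP => /and3P[aY aij aX]; case/eqP: ne; congr inr.
  apply: triple_subset; rewrite ?triples //.
  have sub Z : tr Z \in s -> a \in Z -> Z = a |: [set i; j].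
    move=> Zs aZ; apply/esym/triple_subset; last 1 first.
    - by apply/subsetP => b; rewrite in_setU1 => /predU1P[->|/(subsetP (Yij _ Zs))].
    - by rewrite cardsU1 cards2 ij !inE aij.
    - exact: triples.
  by rewrite (sub Y) // (sub X).
have [[i [j [ijs iX jX]]]|nofull] := classic (exists i j, [/\ pr i j \in s, i \in X & j \in X]).
  have /andP[ij _] := no_cube _ _ ijs.
  have fst k l : pr k l \in s -> k = i.
    move=> kls; have := c _ _ ijs kls; rewrite /= => /orP[/eqP // |/andP[/eqP il /eqP jk]].
    by case: nosym; exists i, j; rewrite ijs {1}jk {1}il.
  have wX : #|X :&: (X :\ i)| = 2.
    rewrite (setIidPr (subsetDl _ _)); have := cardsD1 i X; rewrite iX X3 /=.
    by rewrite add1n => -[].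
  exists (X :\ i) => x xs ne; rewrite [wt (inr X) _]wX.
  case: x xs ne => [[k l]|Y] xs ne.
    by rewrite (fst _ _ xs) /= !inE eqxx /=; case: (_ && _).
  have cX : #|X :\ i| = 2 by rewrite -wX (setIidPr (subsetDl _ _)).
  rewrite ltn_neqAle; apply/andP; split; last by rewrite -cX /= card_le.
  apply: contraNneq ne => /= YE; apply/eqP; congr inr.
  have sub : X :\ i \subset Y.
    have : Y :&: (X :\ i) == X :\ i by rewrite eqEcard subsetIr YE cX.
    by move/eqP/setIidPr.
  apply/esym/triple_subset; rewrite ?triples //; apply/subsetP => a aX.
  have [->|ai] := eqVneq a i; last by apply: (subsetP sub); rewrite !inE ai.
  have jY : j \in Y by apply: (subsetP sub); rewrite !inE jX eq_sym ij.
  by have := c _ _ ijs xs; rewrite /= jY orbF => /andP[].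
exists X => -[[k l]|Y] xs ne; rewrite [wt (inr X) _]/= setIid X3 /=.
  have /andP[kl _] := no_cube _ _ xs.
  case kX: (k \in X); case lX: (l \in X) => //.
  by case: nofull; exists k, l.
rewrite ltn_neqAle -{2}(triples _ xs) subset_leq_card ?subsetIl // andbT.
apply: contraNneq ne => E; apply/eqP; congr inr; apply: triple_subset; rewrite ?triples //.
have : Y :&: X == Y by rewrite eqEcard subsetIl E triples.
by move/eqP/setIidPl.
Qed.

(** Positivity has content for one-vertex faces; it makes A nonempty. *)
Lemma scarf_strict_pos s v : scarf s -> v \in s ->
  exists2 A, (0 < wt v A) & forall x, x \in s -> x != v -> (wt x A < wt v A).
Proof.
move=> Ks vs; have [A A_lt] := scarf_strict Ks vs.
have [s1|[x /andP[xs xv]]] : (forall x, x \in s -> x = v) \/ exists x, (x \in s) && (x != v).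
- have [/existsP[x xP]|/existsPn no] := boolP [exists x, (x \in s) && (x != v)].
    by right; exists x.
  by left=> x xs; have := no x; rewrite xs negbK => /eqP.
- exists setT; last by move=> x /s1->; rewrite eqxx.
  have /scarfP[/(_ _ _ vs vs) + _] := Ks.
  by case: (v) => [[i j] _|X /=]; rewrite /= ?inE // setIT andbb => /eqP->.
- by exists A => //; apply: leq_ltn_trans (A_lt x xs xv).
Qed.

Lemma scarf1 x : scarf [set x] = compat x x.
Proof.
apply/scarfP/idP => [[c _]|cx]; first by apply: c; rewrite inE.
split=> [y z|i j X]; first by rewrite !inE => /eqP-> /eqP->.
by rewrite !inE => /eqP <- _ /eqP.
Qed.

End ScarfComplex.

(** * Counting faces *)

Section BoundShape.

Local Open Scope nat_scope.

Definition bin_shift (n a b : nat) : nat := if b <= a then 'C(n, a - b) else 0.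

Lemma binZ_sub n (a b : nat) (j : int) : (j = a%:Z - b%:Z)%R -> binZ n j = bin_shift n a b.
Proof.
move=> ->; rewrite /bin_shift; case: leqP => [le_ba|lt_ab]; first by rewrite subzn.
have -> : (a%:Z - b%:Z)%R = Negz (b - a).-1.
  by rewrite NegzE prednK ?subn_gt0 // -GRing.opprB subzn // ltnW.
by [].
Qed.

Definition star_term (i q s : nat) : nat :=
  q * 'C(q - 1, s - 1) * bin_shift ('C(q - s, 3) + 'C(q - 1, 2)) (i + 2) s.

(** The last three summands of [p_] are the terms s = q - 2, q - 1, q of the sum. *)
Lemma p_E i q : 5 <= q ->
  p_ i q = q * 'C(q - 1, i) + 'C(q, 2) * bin_shift (q - 2) i 1 +
           \sum_(2 <= s < q.+1) star_term i q s.
Proof.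
move=> q5; rewrite /p_ (@binZ_sub _ (i) (1)) //.
have sumE : \sum_(2 <= s < q - 2)
    q * 'C(q - 1, s - 1) * binZ ('C(q - s, 3) + 'C(q - 1, 2)) (i%:Z - s%:Z + 2)%R
    = \sum_(2 <= s < q - 2) star_term i q s.
  by apply: eq_bigr => s _; rewrite (@binZ_sub _ (i + 2) (s)) //; lia.
rewrite sumE (@binZ_sub _ (i + 2) (q - 2)); last lia.
rewrite (@binZ_sub _ (i + 2) (q - 1)); last lia.
rewrite (@binZ_sub _ (i + 2) (q)); last lia.
have -> : q.+1 = (q - 2).+3 by lia.
rewrite 3?big_nat_recr /=; try lia.
rewrite -!addnA; congr (_ + (_ + (_ + _))).
rewrite /star_term; have -> : (q - 2).+1 = q - 1 by lia.
have -> : (q - 1).+1 = q by lia.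
have -> : q - (q - 2) = 2 by lia.
have -> : q - (q - 1) = 1 by lia.
rewrite subnn (_ : 'C(2, 3) = 0) // (_ : 'C(1, 3) = 0) // (_ : 'C(0, 3) = 0) // !add0n.
rewrite -[q - 2 - 1]subnDA -[q - 1 - 1]subnDA.
have -> : 'C(q - 1, q - (2 + 1)) = 'C(q - 1, 2).
  by rewrite -(@bin_sub _ 2); [congr 'C(_, _) | ]; lia.
have -> : 'C(q - 1, q - (1 + 1)) = q - 1.
  by rewrite -[RHS]bin1 -(@bin_sub _ 1); [congr 'C(_, _) | ]; lia.
by rewrite binn muln1.
Qed.

End BoundShape.

Section FaceCount.

Local Open Scope nat_scope.

Variable q : nat.
Implicit Types (i j : 'I_q) (B X : {set 'I_q}) (N : {set 'I_q * 'I_q}).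
Implicit Types (TT : {set {set 'I_q}}) (s : {set vert q}).

Definition mkface N TT : {set vert q} := (inl @: N) :|: (inr @: TT).
Definition pairs_of s : {set 'I_q * 'I_q} := [set p | inl p \in s].

Definition pairwise N := [forall p in N, forall p' in N, @compat q (inl p) (inl p')].

(** The triples that can be added to the non-square-free vertices in N. Any set of them
    can be added at once, which is why faces are counted by N. *)
Definition allowed N : {set {set 'I_q}} :=
  [set X : {set 'I_q} | [&& #|X| == 3, [forall p in N, @compat q (inl p) (inr X)] &
     [forall p in N, ((p.2, p.1) \in N) ==> (p.1 \in X)]]].

Lemma in_mkface_pr N TT p : (inl p \in mkface N TT) = (p \in N).
Proof.
rewrite inE mem_imset; last by move=> ? ? [].
by case: (p \in N) => //=; apply/imsetP => -[].
Qed.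

Lemma in_mkface_tr N TT X : (inr X \in mkface N TT) = (X \in TT).
Proof.
rewrite inE orbC mem_imset; last by move=> ? ? [].
by case: (X \in TT) => //=; apply/imsetP => -[].
Qed.

Lemma card_mkface N TT : #|mkface N TT| = #|N| + #|TT|.
Proof.
rewrite /mkface cardsU !card_imset; try by move=> ? ? [].
rewrite [X in _ - X](_ : _ = 0) ?subn0 //; apply/eqP; rewrite cards_eq0.
by apply/eqP/setP => -[p|X]; rewrite !inE; apply/andP => -[/imsetP[? _] //] _ /imsetP[].
Qed.

Lemma mkface_pairs s : s = mkface (pairs_of s) [set X | inr X \in s].
Proof. by apply/setP => -[p|X]; rewrite ?in_mkface_pr ?in_mkface_tr inE. Qed.

Lemma scarf_mkface N TT : scarf (mkface N TT) = pairwise N && (TT \subset allowed N).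
Proof.
apply/scarfP/andP => [[c tri]|[/forall_inP pw /subsetP al]]; split.
- apply/forall_inP => p pN; apply/forall_inP => p' pN'.
  by apply: c; rewrite in_mkface_pr.
- apply/subsetP => X XT; rewrite inE; apply/and3P; split.
  + have /= := c (inr X) (inr X); rewrite in_mkface_tr andbb; exact.
  + by apply/forall_inP => p pN; apply: c; rewrite ?in_mkface_pr ?in_mkface_tr.
  + apply/forall_inP => -[i j] pN; apply/implyP => pN'.
    by apply: (tri i j); rewrite ?in_mkface_pr ?in_mkface_tr.
- move=> [p|X] [p'|Y]; rewrite ?in_mkface_pr ?in_mkface_tr.
  + by move=> /pw/forall_inP; apply.
  + by move=> pN /al; rewrite inE => /and3P[_ /forall_inP h _]; apply: h.
  + by move=> /al + pN; rewrite inE compat_sym => /and3P[_ /forall_inP h _]; apply: h.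
  + by move=> /al + /al; rewrite !inE /= => /and3P[-> _ _] /and3P[].
- move=> i j X; rewrite ?in_mkface_pr ?in_mkface_tr => ij ji /al.
  by rewrite inE => /and3P[_ _ /forall_inP/(_ _ ij)]; rewrite /= ji.
Qed.

(** Given N, a face with m vertices is a choice of m - #|N| elements of [allowed N]. *)
Lemma card_faces_split m :
  #|faces (@scarf q) m| = \sum_(N | pairwise N) bin_shift #|allowed N| m #|N|.
Proof.
rewrite -sum1_card (partition_big pairs_of predT) //= [RHS]big_mkcond.
apply: eq_bigr => N _; rewrite sum1dep_card.
pose TTs := [set TT : {set {set 'I_q}} | (TT \subset allowed N) && (#|N| + #|TT| == m)].
have -> : [set s | (s \in faces (@scarf q) m) && (pairs_of s == N)] =
    if pairwise N then mkface N @: TTs else set0.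
  apply/setP => s; rewrite !inE; apply/idP/idP.
    move=> /andP[/andP[Ks sm] /eqP sN].
    move: Ks sm; rewrite (mkface_pairs s) sN scarf_mkface card_mkface => /andP[-> sub] sm.
    by apply: imset_f; rewrite inE sub.
  case: ifP => [pw /imsetP[TT]|]; last by rewrite inE.
  rewrite inE => /andP[sub sm] ->; rewrite scarf_mkface pw sub card_mkface sm /=.
  by apply/eqP/setP => p; rewrite inE in_mkface_pr.
case: ifP => _; last exact: cards0.
rewrite card_imset; last first.
  by move=> TT TT' /setP E; apply/setP => X; have := E (inr X); rewrite !in_mkface_tr.
rewrite /bin_shift; case: leqP => [le_Nm|lt_mN].
  rewrite -cards_draws; apply: eq_card => TT; rewrite !inE.
  by rewrite -[in RHS](eqn_add2l #|N|) subnKC.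
apply/eqP; rewrite cards_eq0; apply/eqP/setP => TT; rewrite !inE.
by apply/andP => -[_ /eqP E]; move: lt_mN; rewrite -E ltnNge leq_addr.
Qed.

(** The vertices 2e_i + e_j with j in B. *)
Definition star i B : {set 'I_q * 'I_q} := [set (i, j) | j in B].

(** For E = {i, j}: the vertices 2e_i + e_j and 2e_j + e_i. *)
Definition swap (E : {set 'I_q}) : {set 'I_q * 'I_q} :=
  [set p | [&& p.1 \in E, p.2 \in E & p.1 != p.2]].

Lemma in_star i B p : (p \in star i B) = (p.1 == i) && (p.2 \in B).
Proof.
case: p => a b; apply/imsetP/andP => /= [[j jB [-> ->]]|[/eqP-> bB]]; last by exists b.
by rewrite eqxx.
Qed.

Lemma card_star i B : #|star i B| = #|B|.
Proof. by rewrite card_imset // => j j' []. Qed.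

Lemma pairwise_star i B : pairwise (star i B).
Proof.
apply/forall_inP => -[a b]; rewrite in_star /= => /andP[/eqP-> _].
by apply/forall_inP => -[a' b']; rewrite in_star /= => /andP[/eqP-> _]; rewrite eqxx.
Qed.

Lemma swap2 i j : i != j -> swap [set i; j] = [set (i, j); (j, i)].
Proof.
move=> ij; apply/setP => -[a b]; rewrite !inE /= !xpair_eqE.
have [->|ai] := eqVneq a i.
  rewrite (negPf ij) /= orbF; have [->|bi] := eqVneq b i; first by rewrite /= (negPf ij).
  by rewrite /= andbT.
have [->|//] := eqVneq a j; rewrite /=.
have [->|bj] := eqVneq b j; first by rewrite /= eq_sym (negPf ij) andbF.
by rewrite /= orbF andbT.
Qed.

Lemma pairwise_cases N : pairwise N = [|| N == set0,
   [exists i, exists B, (B != set0) && (N == star i B)] |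
   [exists E : {set 'I_q}, (#|E| == 2) && (N == swap E)]].
Proof.
apply/idP/idP.
  move=> /forall_inP pw; have [//|nz] := eqVneq N set0 => /=.
  have {}pw i j k l : (i, j) \in N -> (k, l) \in N -> (i == k) || ((i == l) && (j == k)).
    by move=> ij kl; have /forall_inP/(_ _ kl) := pw _ ij.
  have /set0Pn[[i j] ijN] := nz.
  have [st|] := boolP [forall p in N, p.1 == i].
    apply/orP; left; apply/existsP; exists i; apply/existsP.
    exists [set b | (i, b) \in N]; apply/andP; split.
      by apply/set0Pn; exists j; rewrite inE.
    apply/eqP/setP => -[a b]; rewrite in_star inE /=.
    have [->//|ai] := eqVneq a i; apply/negP => abN.
    by have /forall_inP/(_ _ abN) := st; rewrite /= (negPf ai).
  rewrite negb_forall_in => /existsP[[a b] /andP[abN /= ai]].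
  have := pw _ _ _ _ ijN abN; rewrite eq_sym (negPf ai) /= => /andP[/eqP ib /eqP ja].
  subst a b; apply/orP; right; apply/existsP; exists [set i; j].
  have ij : i != j by rewrite eq_sym.
  rewrite cards2 ij swap2 //; apply/eqP/setP => -[a b]; rewrite !inE !xpair_eqE.
  apply/idP/idP => [cdN|/orP[/andP[/eqP-> /eqP->]|/andP[/eqP-> /eqP->]] //].
  have /orP[/eqP ia|/andP[/eqP-> /eqP->]] := pw _ _ _ _ ijN cdN; last by rewrite !eqxx orbT.
  subst a; have := pw _ _ _ _ abN cdN; rewrite eq_sym (negPf ij) /= => /andP[/eqP-> _].
  by rewrite !eqxx.
case/or3P => [/eqP->|/existsP[i /existsP[B /andP[_ /eqP->]]]|/existsP[E /andP[E2 /eqP->]]].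
- by apply/forall_inP => p; rewrite inE.
- exact: pairwise_star.
have /cards2P[i [j [ij EE]]] := E2; rewrite EE swap2 //.
by apply/forall_inP => p /set2P[] ->; apply/forall_inP => p' /set2P[] ->;
   rewrite /= !eqxx ?orbT.
Qed.

Lemma allowed0 : #|allowed set0| = 'C(q, 3).
Proof.
rewrite -[q in RHS]card_ord -card_draws; apply: eq_card => X; rewrite !inE.
case: (#|X| == 3) => //=; apply/andP; split; apply/forall_inP => p; by rewrite inE.
Qed.

Lemma allowed_star_cube i B : i \in B -> #|allowed (star i B)| = 0.
Proof.
move=> iB; apply/eqP; rewrite cards_eq0; apply/eqP/setP => X; rewrite !inE.
apply/negP => /and3P[_ /forall_inP/(_ (i, i)) + _].
by rewrite in_star eqxx iB /= eqxx => /(_ isT).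
Qed.

(** Either X contains i, or X avoids both i and B. *)
Lemma allowed_star i B : i \notin B -> B != set0 ->
  #|allowed (star i B)| = 'C(q - #|B| - 1, 3) + 'C(q - 1, 2).
Proof.
move=> iB /set0Pn[b0 b0B].
have E X : (X \in allowed (star i B)) =
    (#|X| == 3) && ((i \in X) || [disjoint X & B]).
  rewrite inE; case: (#|X| == 3) => //=; apply/andP/idP => [[/forall_inP c _]|c].
    have [//|iX] := boolP (i \in X); apply/pred0P => b /=; apply/negP => /andP[bX bB].
    by have := c (i, b); rewrite in_star eqxx bB /= bX (negPf iX) andbF => /(_ isT).
  split; apply/forall_inP => -[a b]; rewrite in_star /= => /andP[/eqP-> bB].
    rewrite (contraNneq _ iB) => [|->//] /=; have [//|iX] := boolP (i \in X).
    by move: c; rewrite (negPf iX) /= => /disjointFl ->.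
  apply/implyP; rewrite in_star /= => /andP[_ iB']; by rewrite iB' in iB.
have C1 : #|~: [set i]| = q - 1 by rewrite cardsC1 card_ord subn1.
have C2 : #|~: (i |: B)| = q - #|B| - 1.
  by rewrite cardsCs setCK cardsU1 iB card_ord -subnDA addn1.
have -> : allowed (star i B) = [set X : {set 'I_q} | X \subset ~: (i |: B) & #|X| == 3] :|:
    [set X : {set 'I_q} | #|X| == 3 & i \in X].
  apply/setP => X; rewrite E !inE subsetC subUset sub1set inE.
  rewrite -disjoints_subset disjoint_sym.
  by case: (i \in X); case: (#|X| == 3); case: [disjoint _ & _].
rewrite cardsU [X in _ - X](_ : _ = 0) ?subn0; last first.
  apply/eqP; rewrite cards_eq0; apply/eqP/setP => X; rewrite !inE.
  apply/negP => /andP[/andP[/subsetP sub _] /andP[_ /sub]].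
  by rewrite !inE eqxx.
rewrite cards_draws C2; congr (_ + _).
have D : #|[set X : {set 'I_q} | X \subset ~: [set i] & #|X| == 3]| = 'C(q - 1, 3).
  by rewrite cards_draws C1.
have Cq : 'C(q, 3) = 'C(q - 1, 3) + 'C(q - 1, 2).
  have q0 : 0 < q := leq_ltn_trans (leq0n i) (ltn_ord i).
  by rewrite -{1}(subnK q0) addn1 binS.
apply: (@addnI 'C(q - 1, 3)); rewrite -Cq -D.
rewrite -[q in RHS]card_ord -card_draws -[RHS](cardsID [set X : {set 'I_q} | i \in X]) [RHS]addnC.
by congr (_ + _); apply: eq_card => X; rewrite !inE // subsetC sub1set inE.
Qed.

(** Such an X is E with one more element. *)
Lemma allowed_swap (E : {set 'I_q}) : #|E| == 2 -> #|allowed (swap E)| = q - 2.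
Proof.
move=> E2; have /cards2P[i [j [ij EE]]] := E2.
have -> : allowed (swap E) = [set a |: E | a in ~: E].
  apply/setP => X; rewrite inE EE swap2 //; apply/and3P/imsetP => [[/eqP X3 _ /forall_inP h]|].
    have iX : i \in X by have := h (i, j); rewrite !inE !eqxx !orbT => /(_ isT).
    have jX : j \in X by have := h (j, i); rewrite !inE !eqxx !orbT => /(_ isT).
    have sub : [set i; j] \subset X by apply/subsetP => a /set2P[] ->.
    have /cards1P[a aE] : #|X :\: [set i; j]| == 1.
      by rewrite cardsD (setIidPr sub) X3 cards2 ij.
    have : a \in X :\: [set i; j] by rewrite aE inE.
    rewrite inE => /andP[aij aX]; exists a; first by rewrite inE.
    apply/setP => b; rewrite in_setU1 -in_set1 -aE in_setD.
    have [bE|_] /= := boolP (b \in [set i; j]); first by rewrite (subsetP sub _ bE).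
    by rewrite orbF.
  case=> a; rewrite inE => aij ->; split.
  - by rewrite cardsU1 aij cards2 ij.
  - apply/forall_inP => p /set2P[] -> /=; first by rewrite ij !inE eqxx ?orbT.
    by rewrite eq_sym ij !inE eqxx ?orbT.
  - by apply/forall_inP => p /set2P[] -> /=; rewrite !inE !eqxx ?orbT.
rewrite card_in_imset => [|a b]; first by rewrite cardsCs setCK (eqP E2) card_ord.
rewrite !inE => aE bE /setP/(_ a); rewrite !inE eqxx /=.
by rewrite (negPf aE) orbF => /esym/eqP.
Qed.

Lemma sum_pairwise (g : {set 'I_q * 'I_q} -> nat) :
  \sum_(N | pairwise N) g N = g set0 + \sum_i \sum_(B : {set 'I_q} | B != set0) g (star i B)
    + \sum_(E : {set 'I_q} | #|E| == 2) g (swap E).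
Proof.
pose is_star N := [exists i, exists B : {set 'I_q}, (B != set0) && (N == star i B)].
have star_nz i B : B != set0 -> star i B != set0.
  by move=> /set0Pn[b bB]; apply/set0Pn; exists (i, b); rewrite in_star eqxx.
have swap_nstar (E : {set 'I_q}) : #|E| == 2 -> ~~ is_star (swap E) /\ swap E != set0.
  move=> /cards2P[i [j [ij ->]]]; rewrite swap2 //; split; last first.
    by apply/set0Pn; exists (i, j); rewrite !inE eqxx.
  apply/negP => /existsP[a /existsP[B /andP[_ /eqP/setP e]]].
  have := e (i, j); rewrite in_star !inE eqxx /= => /esym/andP[/eqP ia _].
  have := e (j, i); rewrite in_star !inE eqxx orbT /= => /esym/andP[/eqP ja _].
  by rewrite ia ja eqxx in ij.
rewrite (bigD1 set0) /=; last by rewrite pairwise_cases eqxx.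
rewrite -addnA; congr (_ + _); rewrite (bigID is_star) /=; congr (_ + _).
  rewrite pair_big_dep /=.
  pose D := [set x : 'I_q * {set 'I_q} | x.2 != set0].
  transitivity (\sum_(N in [set star x.1 x.2 | x in D]) g N).
    apply: eq_bigl => N; apply/andP/imsetP => [[_ /existsP[i /existsP[B /andP[nz /eqP->]]]]|].
      by exists (i, B); rewrite // inE.
    case=> -[i B]; rewrite inE /= => nz ->; split; first by rewrite pairwise_star star_nz.
    by apply/existsP; exists i; apply/existsP; exists B; rewrite nz eqxx.
  rewrite big_imset => [|[i B] [j C]] /=; first by apply: eq_bigl => x; rewrite inE.
  rewrite !inE /= => /set0Pn[b bB] _ /setP e.
  have := e (i, b); rewrite !in_star eqxx bB /= => /esym/andP[/eqP <- _].
  congr pair; apply/setP => c; have := e (i, c); rewrite !in_star eqxx /= => ->.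
  have := e (i, b); rewrite !in_star eqxx bB /= => /esym/andP[-> _] //.
transitivity (\sum_(N in [set swap E | E in [set E : {set 'I_q} | #|E| == 2]]) g N).
  apply: eq_bigl => N; rewrite pairwise_cases; apply/andP/imsetP.
    case=> /andP[/or3P[/eqP->|st|/existsP[E /andP[E2 /eqP->]]] nz] ns; first by rewrite eqxx in nz.
      by rewrite /is_star st in ns.
    by exists E; rewrite ?inE.
  case=> E; rewrite inE => E2 ->; have [ns nz] := swap_nstar E E2; split=> //.
  by rewrite nz andbT; apply/or3P/Or33/existsP; exists E; rewrite E2 eqxx.
rewrite big_imset => [|E F] /=; first by apply: eq_bigl => x; rewrite inE.
have supp (C : {set 'I_q}) : #|C| == 2 -> C = [set p.1 | p in swap C].
  move=> C2; apply/setP => a; apply/idP/imsetP => [aC|[p]]; last first.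
    by rewrite inE => /and3P[? _ _] ->.
  have /card_gt0P[b] : 0 < #|C :\ a| by move: C2; rewrite (cardsD1 a) aC add1n eqSS => /eqP->.
  rewrite !inE => /andP[ba bC]; exists (a, b) => //.
  by rewrite inE /= aC bC eq_sym.
by rewrite !inE => /supp EE /supp FE sEF; rewrite EE FE sEF.
Qed.

Lemma sum_subsets (A : {set 'I_q}) (h : nat -> nat) :
  \sum_(B : {set 'I_q} | B \subset A) h #|B| = \sum_(b < #|A|.+1) 'C(#|A|, b) * h b.
Proof.
rewrite (partition_big (fun B : {set 'I_q} => inord #|B| : 'I_#|A|.+1) predT) //=.
apply: eq_bigr => b _; rewrite -cards_draws -sum1dep_card big_distrl /=.
apply: eq_big => [B|B /andP[sub /eqP <-]].
  have [sub|//] := boolP (B \subset A); rewrite /= -val_eqE /= inordK //.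
  by rewrite ltnS subset_leq_card.
by rewrite mul1n inordK // ltnS subset_leq_card.
Qed.

Lemma sum_subsets_notin i (h : nat -> nat) :
  \sum_(B : {set 'I_q} | i \notin B) h #|B| = \sum_(b < q) 'C(q - 1, b) * h b.
Proof.
have C1 : #|~: [set i]| = q - 1 by rewrite cardsC1 card_ord subn1.
have q0 : 0 < q := leq_ltn_trans (leq0n i) (ltn_ord i).
have := sum_subsets (~: [set i]) h; rewrite C1 subn1 prednK // => <-.
by apply: eq_bigl => B; rewrite subsetC sub1set inE.
Qed.

Lemma sum_subsets_in i (h : nat -> nat) :
  \sum_(B : {set 'I_q} | i \in B) h #|B| = \sum_(b < q) 'C(q - 1, b) * h b.+1.
Proof.
rewrite -(sum_subsets_notin i (fun b => h b.+1)).
rewrite (reindex_onto (fun B => i |: B) (fun B => B :\ i)) => [|B iB]; last exact: setD1K.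
apply: eq_big => [B|B]; last by move=> /andP[_ /eqP <-]; rewrite cardsU1 !inE eqxx.
rewrite setU11 /=; apply/eqP/idP => [<-|iB]; first by rewrite !inE eqxx.
by rewrite setU1K.
Qed.

(** The faces are sorted by their set N of non-square-free vertices. The empty N gives
    the first binomial coefficient; [star i B] with i in B gives the faces containing 3
    e_i, which have no triples; [swap E] gives the second summand of [p_E]; and [star i
    B] with i not in B and s - 1 elements in B gives the term s of the sum. *)
Theorem card_scarf_faces (i : nat) : 5 <= q ->
  #|faces (@scarf q) i.+1| = 'C('C(q, 3), i.+1) + p_ i q.
Proof.
move=> q5; rewrite card_faces_split sum_pairwise p_E //.
rewrite cards0 allowed0 {1}/bin_shift leq0n subn0 -addnA; congr (_ + _).
rewrite [RHS]addnAC; congr (_ + _); last first.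
  rewrite (eq_bigr (fun=> bin_shift (q - 2) i 1)) => [|E E2].
    by rewrite sum_nat_cond_const card_draws card_ord.
  rewrite allowed_swap //; have /cards2P[a [b [ab EE]]] := E2.
  by rewrite EE swap2 // cards2 xpair_eqE (negPf ab) /bin_shift ltnS subSS.
pose h b := if b == 0 then 0 else bin_shift ('C(q - b - 1, 3) + 'C(q - 1, 2)) i.+1 b.
transitivity (\sum_(a < q) ('C(q - 1, i) + \sum_(b < q) 'C(q - 1, b) * h b)).
  apply: eq_bigr => a _; rewrite (bigID (fun B : {set 'I_q} => a \in B)) /=; congr (_ + _).
    rewrite (eq_big (fun B : {set 'I_q} => a \in B) (fun B => bin_shift 0 i.+1 #|B|)).
    - rewrite sum_subsets_in; have [lt_iq|ge_iq] := ltnP i q.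
        rewrite (bigD1 (Ordinal lt_iq)) //= /bin_shift leqnn subnn muln1 big1 ?addn0 // => b.
        rewrite -val_eqE /= ltnS subSS => ne; case: leqP => le_bi; rewrite ?muln0 //.
        by rewrite (@bin_small 0) ?muln0 // subn_gt0 ltn_neqAle ne.
      rewrite bin_small; last by rewrite subn1 prednK // (leq_trans _ q5).
      apply: big1 => b _; rewrite /bin_shift ltnS subSS; case: leqP => le_bi; rewrite ?muln0 //.
      by rewrite (@bin_small 0) ?muln0 // subn_gt0 (leq_trans (ltn_ord b)).
    - by move=> B; rewrite andbC; case: (boolP (a \in B)) => //= aB; apply/set0Pn; exists a.
    - by move=> B /andP[_ aB]; rewrite allowed_star_cube // card_star.
  rewrite -(sum_subsets_notin a h) [LHS]big_mkcond [RHS]big_mkcond; apply: eq_bigr => B _.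
  rewrite /h cards_eq0; have [->|nz] /= := eqVneq B set0; first by rewrite if_same.
  by case: ifP => // aB; rewrite allowed_star // card_star.
rewrite sum_nat_const card_ord mulnDr; congr (_ + _).
rewrite big_distrr /= -(big_mkord predT (fun b => q * ('C(q - 1, b) * h b))).
rewrite [LHS]big_ltn ?(leq_trans _ q5) // /h /= !muln0 add0n [RHS]big_add1 /=.
apply: eq_big_nat => s /andP[s1 _]; rewrite /star_term; case: s s1 => // s _.
rewrite !subn1 /= -mulnA; congr (_ * (_ * _)).
by rewrite /bin_shift addn2 !ltnS !subSS [in RHS]subnS.
Qed.

End FaceCount.

(** * Polynomiality of the face count *)

Definition ffact_poly (a : {poly rat}) (k : nat) : {poly rat} :=
  \prod_(j < k) (a - j%:R%:P).
Definition bin_poly (a : {poly rat}) (k : nat) : {poly rat} :=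
  (k`!%:R)^-1 *: ffact_poly a k.

Lemma prod_ffact (n k : nat) : \prod_(j < k) (n%:R - j%:R) = (n ^_ k)%:R :> rat.
Proof.
elim: k => [|k IH]; first by rewrite big_ord0 ffactn0.
rewrite big_ord_recr IH /= ffactnSr natrM; have [le_kn|lt_nk] := leqP k n.
  by rewrite natrB.
by rewrite ffact_small // !mul0r.
Qed.

Lemma bin_poly_eval (a : {poly rat}) k x n : a.[x] = n%:R -> (bin_poly a k).[x] = 'C(n, k)%:R.
Proof.
move=> ax; rewrite hornerZ horner_prod.
rewrite (eq_bigr (fun j : 'I_k => n%:R - j%:R)) => [|j _]; last by rewrite !hornerE ax.
have fk : k`!%:R != 0 :> rat by rewrite pnatr_eq0 -lt0n fact_gt0.
by rewrite prod_ffact -bin_ffact natrM mulrC mulfK.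
Qed.

Lemma size_bin_poly (a : {poly rat}) k d : size a = d.+2 -> size (bin_poly a k) = (k * d.+1).+1.
Proof.
move=> sa; rewrite size_scale ?invr_eq0 ?pnatr_eq0 -?lt0n ?fact_gt0 //.
have sj (j : nat) : size (a - j%:R%:P) = d.+2.
  by rewrite size_polyDl ?sa // size_polyN (leq_ltn_trans (size_polyC_leq1 _)).
elim: k => [|k IH]; first by rewrite /ffact_poly big_ord0 size_poly1.
rewrite /ffact_poly big_ord_recr size_mul -?size_poly_eq0 ?sj //= ?IH //.
by rewrite addSn addnS /= mulSn addnC.
Qed.

(** The term s of the sum in [p_E] as a polynomial in q. *)
Definition star_poly (i s : nat) : {poly rat} :=
  'X * bin_poly ('X - 1) (s - 1) *
  bin_poly (bin_poly ('X - s%:R%:P) 3 + bin_poly ('X - 1) 2) (i + 2 - s).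

Lemma size_XsubC' (s : nat) : size ('X - s%:R%:P : {poly rat}) = 2.
Proof. exact: size_XsubC. Qed.

Lemma size_Xsub1 : size ('X - 1 : {poly rat}) = 2.
Proof. by rewrite -polyC1 size_XsubC. Qed.

Lemma size_star_poly i s : (0 < s)%N -> (s <= i + 2)%N ->
  size (star_poly i s) = (s + (i + 2 - s) * 3).+1.
Proof.
move=> s0 le_s.
have s1 : size (bin_poly ('X - 1) (s - 1)) = s.
  by rewrite (size_bin_poly _ size_Xsub1) muln1 subn1 prednK.
have s3 : size (bin_poly ('X - s%:R%:P) 3 + bin_poly ('X - 1) 2) = 4.
  by rewrite size_polyDl ?(size_bin_poly _ (size_XsubC' s)) // (size_bin_poly _ size_Xsub1).
have sk := size_bin_poly (i + 2 - s) s3.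
have sX : size ('X * bin_poly ('X - 1) (s - 1)) = s.+1.
  by rewrite mulrC size_mulX ?s1 // -size_poly_eq0 s1 -lt0n.
by rewrite size_mul -?size_poly_eq0 ?sX ?sk //= addnS.
Qed.

Lemma eval_Xsub (q s : nat) : (s <= q)%N -> ('X - s%:R%:P : {poly rat}).[q%:R] = (q - s)%:R.
Proof. by move=> le_sq; rewrite !hornerE natrB. Qed.

Lemma eval_Xsub1 (q : nat) : (0 < q)%N -> ('X - 1 : {poly rat}).[q%:R] = (q - 1)%:R.
Proof. by move=> q0; rewrite -(eval_Xsub q0). Qed.

(** For s > q both sides vanish because of the factor binomial(q - 1, s - 1), although
    the last factor of the polynomial need not be a binomial coefficient then. *)
Lemma star_poly_eval i q s : (0 < q)%N -> (s <= i + 2)%N ->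
  (star_poly i s).[q%:R] = (star_term i q s)%:R.
Proof.
move=> q0 le_s; rewrite /star_term /bin_shift le_s !hornerM hornerX !natrM.
rewrite (bin_poly_eval _ (eval_Xsub1 q0)).
have [le_sq|lt_qs] := leqP s q; last first.
  by rewrite (@bin_small (q - 1) (s - 1)) ?mulr0 ?mul0r // ltn_sub2r // (leq_ltn_trans q0).
congr (_ * _); apply: bin_poly_eval.
rewrite hornerD (bin_poly_eval _ (eval_Xsub le_sq)) (bin_poly_eval _ (eval_Xsub1 q0)).
by rewrite natrD.
Qed.

Lemma sum_star_term i q : (0 < q)%N ->
  \sum_(2 <= s < q.+1) star_term i q s = \sum_(2 <= s < i.+3) star_term i q s.
Proof.
move=> q0; pose N := maxn q.+1 i.+3.
have ext m : (2 <= m)%N -> (m <= N)%N -> (forall s, (m <= s)%N -> star_term i q s = 0%N) ->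
    \sum_(2 <= s < m) star_term i q s = \sum_(2 <= s < N) star_term i q s.
  move=> m2 mN z; rewrite [RHS](@big_cat_nat _ _ _ m) //=.
  rewrite -[LHS]addn0; congr (_ + _)%N.
  by rewrite big_nat_cond big1 // => s /andP[/andP[/z]].
rewrite !ext // ?leq_maxl ?leq_maxr // /star_term => s.
  by move=> lt_s; rewrite /bin_shift leqNgt addn2 lt_s muln0.
by move=> lt_s; rewrite (@bin_small (q - 1)) ?muln0 // ltn_sub2r // (leq_ltn_trans q0).
Qed.

(** The range of s can be taken to be 2 <= s <= i + 2, independently of q. The term s
    has degree 3 i + 6 - 2 s, and the first two summands have degree at most i + 1, so
    the term s = 2 alone has the top degree. *)
Theorem p_polynomial i : exists P : {poly rat}, size P = (3 * i + 2).+1 /\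
  forall q : nat, (5 <= q)%N -> (p_ i q)%:R = P.[q%:R].
Proof.
pose T1 := 'X * bin_poly ('X - 1) i.
pose T2 := if i is j.+1 then bin_poly 'X 2 * bin_poly ('X - 2%:R%:P) j else 0.
pose T3 := \sum_(3 <= s < i.+3) star_poly i s.
have sT1 : (size T1 <= i.+2)%N.
  rewrite /T1 mulrC (leq_trans (size_polyMleq _ _)) //.
  by rewrite (size_bin_poly _ size_Xsub1) size_polyX; lia.
have sT2 : (size T2 <= i.+2)%N.
  rewrite /T2; case: (i) => [|j]; first by rewrite size_poly0.
  rewrite (leq_trans (size_polyMleq _ _)) // (size_bin_poly _ (size_XsubC' 2)).
  by rewrite (size_bin_poly 2 (d := 0)) ?size_polyX //; lia.
have sT3 : (size T3 <= 3 * i + 1)%N.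
  rewrite /T3 big_nat_cond; apply: (leq_trans (size_sum _ _ _)).
  by apply/bigmax_leqP_seq => s _ /andP[/andP[s3 si] _]; rewrite size_star_poly; lia.
have sT : size (star_poly i 2) = (3 * i + 2).+1 by rewrite size_star_poly; lia.
exists (star_poly i 2 + (T1 + T2 + T3)); split.
  rewrite size_polyDl ?sT //; apply: leq_ltn_trans (size_polyD _ _) _.
  rewrite gtn_max (leq_ltn_trans sT3) ?andbT; last lia.
  apply: leq_ltn_trans (size_polyD _ _) _; rewrite gtn_max.
  by rewrite (leq_ltn_trans sT1) ?(leq_ltn_trans sT2) //; lia.
move=> q q5; have q0 : (0 < q)%N by lia.
rewrite p_E // sum_star_term // big_ltn // !natrD !hornerD star_poly_eval //; last lia.
rewrite [RHS]addrC [in RHS]addrAC -[in RHS]addrA.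
have -> : T1.[q%:R] = (q * 'C(q - 1, i))%:R.
  by rewrite /T1 hornerM hornerX (bin_poly_eval _ (eval_Xsub1 q0)) natrM.
have -> : T2.[q%:R] = ('C(q, 2) * bin_shift (q - 2) i 1)%:R.
  rewrite /T2 /bin_shift; case: (i) => [|j]; first by rewrite horner0 muln0.
  rewrite hornerM (@bin_poly_eval _ _ _ q) ?hornerX // natrM; congr (_ * _).
  by rewrite subn1; apply/bin_poly_eval/eval_Xsub; lia.
have -> : T3.[q%:R] = (\sum_(3 <= s < i.+3) star_term i q s)%:R.
  rewrite natr_sum horner_sum; apply: eq_big_nat => s /andP[_ si].
  by rewrite star_poly_eval //; lia.
by rewrite -!natrD; congr (_%:R); lia.
Qed.

(** * Third powers of square-free monomial ideals *)

Section Ideals.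

Variable R : comNzRingType.
Implicit Types (I K L G : R -> Prop).

Definition ideal_closed L := L 0 /\ forall c f g, L f -> L g -> L (f + c * g).

Lemma ideal_gen_closed G : ideal_closed (ideal_gen G).
Proof.
split=> [|c f g [s [sG ->]] [t [tG ->]]]; first by exists [::]; split=> //; rewrite big_nil.
exists (s ++ [seq (c * p.1, p.2) | p <- t]); split=> [p|].
  by rewrite mem_cat => /orP[/sG //|/mapP[p' /tG ? ->]].
rewrite big_cat big_map /= mulr_sumr; congr (_ + _).
by apply: eq_bigr => p _; rewrite mulrA.
Qed.

Lemma ideal_gen_mem G g : G g -> ideal_gen G g.
Proof.
move=> Gg; exists [:: (1, g)]; split=> [p|]; first by rewrite inE => /eqP->.
by rewrite big_seq1 mul1r.
Qed.

Lemma ideal_closedMl L c f : ideal_closed L -> L f -> L (c * f).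
Proof. by move=> [L0 Llin] Lf; rewrite -[c * f]add0r; apply: Llin. Qed.

Lemma ideal_gen_min G L : ideal_closed L -> (forall g, G g -> L g) ->
  forall f, ideal_gen G f -> L f.
Proof.
move=> Lc GL f [s [sG ->]]; rewrite big_seq.
elim/big_ind: _ => [|a b La Lb|p /sG/GL]; first exact: Lc.1.
  by rewrite -[b]mul1r; apply: Lc.2.
exact: ideal_closedMl.
Qed.

Lemma ideal_mul_min G K L : ideal_closed L -> (forall g b, G g -> K b -> L (g * b)) ->
  forall f, ideal_mul (ideal_gen G) K f -> L f.
Proof.
move=> Lc GKL; apply: ideal_gen_min => // _ [a [b [Ga Kb ->]]].
apply: (ideal_gen_min (L := fun a => L (a * b))) Ga => [|g Gg]; last exact: GKL.
by split=> [|c f g Lf Lg]; rewrite ?mul0r ?mulrDl -?mulrA; [apply: Lc.1 | apply: Lc.2].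
Qed.

Lemma ideal_mul_mem I K a b : I a -> K b -> ideal_mul I K (a * b).
Proof. by move=> Ia Kb; apply: ideal_gen_mem; exists a, b. Qed.

End Ideals.

Lemma cards3P (T : finType) (X : {set T}) : #|X| = 3 -> exists a b c,
  [/\ a != b, a != c, b != c & X = [set a; b; c]].
Proof.
move=> X3; have /card_gt0P[a aX] : (0 < #|X|)%N by rewrite X3.
have /eqP/cards2P[b [c [bc E]]] : #|X :\ a| = 2.
  by apply/eqP; move: X3; rewrite (cardsD1 a) aX add1n => /eqP; rewrite eqSS.
have: (b \in X :\ a) && (c \in X :\ a) by rewrite E !inE !eqxx orbT.
rewrite !inE => /andP[/andP[ba _] /andP[ca _]]; exists a, b, c.
split=> //; try by rewrite eq_sym.
by rewrite -(setD1K aX) E setUA.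
Qed.

Section ThirdPower.

Variables (k : fieldType) (n q : nat) (m : 'I_q -> 'X_{1..n}).
Local Notation S := {mpoly k[n]}.

(** The product of generators indexed by the vertex x. *)
Definition label (x : vert q) : 'X_{1..n} :=
  match x with
  | inl (i, j) => (m i + (m i + m j))%MM
  | inr X => (\sum_(i in X) m i)%MM
  end.

Lemma label_prod3 a b c : exists2 x, compat x x & label x = (m a + (m b + m c))%MM.
Proof.
have [->|ab] := eqVneq a b; first by exists (inl (b, c)); rewrite /= ?eqxx.
have [->|ac] := eqVneq a c.
  by exists (inl (c, b)); rewrite /= ?eqxx // [(m b + _)%MM]addmC.
have [->|bc] := eqVneq b c.
  by exists (inl (c, a)); rewrite /= ?eqxx // [RHS]addmC -addmA.
exists (inr [set a; b; c]); first by rewrite /= cards3.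
rewrite /= -setUA big_setU1 ?inE ?negb_or ?ab ?ac //= big_setU1 ?inE //=.
by rewrite big_set1.
Qed.

Definition power3 := ideal_exp (@monomial_ideal k n q m) 3.

Definition label_span (f : S) : Prop :=
  exists c : vert q -> S, f = \sum_(x | scarf [set x]) c x * 'X_[label x].

Lemma label_span_closed : ideal_closed label_span.
Proof.
split=> [|a f g [c ->] [d ->]]; first by exists (fun=> 0); rewrite big1 // => x _; rewrite mul0r.
exists (fun x => c x + a * d x); rewrite mulr_sumr -big_split /=.
by apply: eq_bigr => x _; rewrite mulrDl mulrA.
Qed.

(** Both sides are the ideal generated by the products of three generators. *)
Lemma power3E (f : S) : power3 f <-> label_span f.
Proof.
split.
  apply: ideal_mul_min => [|_ b [i1 ->]]; first exact: label_span_closed.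
  have [L0 Llin] := label_span_closed.
  have mulL (g : S) (L : S -> Prop) : ideal_closed L -> ideal_closed (fun b => L (g * b)).
    move=> [L0' Llin']; split=> [|c f' g' Lf Lg]; first by rewrite mulr0.
    by rewrite mulrDr mulrCA; apply: Llin'.
  apply: (ideal_mul_min (L := fun b => label_span ('X_[m i1] * b))) => [|_ {}b [i2 ->]].
    exact: mulL label_span_closed.
  pose L2 (b : S) := label_span ('X_[m i1] * ('X_[m i2] * b)).
  apply: (ideal_mul_min (L := L2)) => [|_ {}b [i3 ->] _].
    exact: (mulL _ (fun b => label_span ('X_[m i1] * b)) (mulL _ _ label_span_closed)).
  have [x cx xE] := label_prod3 i1 i2 i3.
  exists (fun y => if y == x then b else 0).
  rewrite (bigD1 x) ?scarf1 //= eqxx big1 ?addr0 => [|y /andP[_ /negPf->]]; last by rewrite mul0r.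
  by rewrite xE !mpolyXD !mulrA mulrC !mulrA.
move=> [c ->]; have Jc : ideal_closed power3 by apply: ideal_gen_closed.
have gen3 a b d : power3 'X_[(m a + (m b + m d))%MM].
  rewrite !mpolyXD -['X_[m d]]mulr1.
  by do 3! [apply: ideal_mul_mem; first by apply: ideal_gen_mem; eexists].
elim/big_ind: _ => [|f' g Jf Jg|x]; first exact: Jc.1.
  by rewrite -[g]mul1r; apply: Jc.2.
rewrite scarf1 => cx; apply: ideal_closedMl => //; case: x cx => [[i j] _|X]; first exact: gen3.
rewrite /= andbb => /eqP/cards3P[a [b [d [ab ad bd ->]]]].
rewrite -setUA big_setU1 ?inE ?negb_or ?ab ?ad //= big_setU1 ?inE //= big_set1.
exact: gen3.
Qed.

Lemma power3_pihomog d f : power3 f -> power3 (pihomog mdeg d f).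
Proof.
move=> /power3E[c ->]; apply/power3E; rewrite raddf_sum /=.
exists (fun x => if (mdeg (label x) <= d)%N then pihomog mdeg (d - mdeg (label x)) (c x) else 0).
apply: eq_bigr => x _; rewrite (@pihomogMr _ _ (mdeg (label x))) ?dhomogX //.
by case: ifP; rewrite ?mul0r.
Qed.

Lemma minres_power3 : minimal_free_resolution power3 (minres power3).
Proof.
apply: epsilon_spec; apply: minimal_resolution_exists.
- exact: (ideal_gen_closed _).1.
- exact: (ideal_gen_closed _).2.
- exact: power3_pihomog.
Qed.

Hypothesis m_sqfree : forall i, squarefree_monom (m i).

(** Square-freeness of the generators makes the exponents of a label depend on the sets
    of generators divisible by the single variables. *)
Lemma label_wt x j : label x j = wt x [set i | m i j == 1%N].
Proof.
have mE i : m i j = (i \in [set i | m i j == 1%N]).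
  by rewrite inE; have := m_sqfree i j; case: (m i j) => [|[]].
case: x => [[a b]|X] /=.
  by rewrite !mnmDE !mE addnA mul2n -addnn.
rewrite mnm_sumE -sum1_card big_mkcond [RHS]big_mkcond; apply: eq_bigr => i _.
by rewrite in_setI; case: ifP => // _; rewrite mE; case: (i \in _).
Qed.

(** Divisibility of labels into u is closed in the sense of [ok_scarf_acyclic], by
    [label_wt]. *)
Lemma scarf_acyclic_below u :
  (exists x, scarf [set x] && (label x <= u)%MM) ->
  acyclic k (fun s => @scarf q s && (lcm_label label s <= u)%MM).
Proof.
move=> [x0 /andP[]]; rewrite scarf1 => cx0 okx0.
pose ok : pred (vert q) := fun x => (label x <= u)%MM.
apply: (@acyclic_ext _ _ (ok_scarf ok)) => [s|].
  rewrite /ok_scarf; congr (_ && _); apply/forall_inP/lcm_labelP; exact.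
apply: ok_scarf_acyclic; last by exists x0; rewrite /okv cx0.
move=> xs y /allP okxs le_y; apply/mnm_lepP => j; rewrite label_wt.
apply: leq_trans (le_y _) _; apply/bigmax_leqP_seq => x xxs _.
by rewrite -label_wt; have /mnm_lepP := okxs x xxs.
Qed.

Definition scarf_seq := simplicial_seq k (@scarf q) label.

Lemma scarf_seq_resolves : resolves power3 scarf_seq.
Proof.
apply: simplicial_resolves; [exact: scarf_down | exact: scarf_acyclic_below | exact: power3E].
Qed.

Hypothesis q5 : (5 <= q)%N.

Lemma rk_scarf_seq i : rk scarf_seq i = ('C('C(q, 3), i.+1) + p_ i q)%N.
Proof. exact (card_scarf_faces i q5). Qed.

Lemma betti_power3_le i : (betti power3 i <= 'C('C(q, 3), i.+1) + p_ i q)%N.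
Proof.
rewrite -rk_scarf_seq; have [_ res min] := minres_power3.
exact: minimal_rk_le res scarf_seq_resolves min.
Qed.

End ThirdPower.

(** Raising d by one adds 1 on the left and binomial(m + d, 2) on the right; the cases
    with m + d = 4 start the induction. *)
Lemma bin3_add m d : (4 <= m + d)%N -> ('C(m, 3) + d <= 'C(m + d, 3))%N.
Proof.
elim: d => [|d IH]; first by rewrite !addn0.
rewrite addnS ltnS leq_eqVlt => /predU1P[E|lt].
  have cases : (m = 0 /\ d = 3) \/ (m = 1 /\ d = 2) \/ (m = 2 /\ d = 1) \/ (m = 3 /\ d = 0).
    by lia.
  by move: cases => [[-> ->]|[[-> ->]|[[-> ->]|[-> ->]]]].
rewrite binS addnS -addn1 leq_add ?IH // bin_gt0; lia.
Qed.

(** In terms of the complex: no face has more than binomial(q, 3) vertices. *)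
Lemma bound_eq0 q i : (5 <= q)%N -> ('C(q, 3) <= i)%N ->
  ('C('C(q, 3), i.+1) + p_ i q = 0)%N.
Proof.
move=> q5 le_i; have := @bin3_add 0 q (ltnW q5); rewrite (_ : 'C(0, 3) = 0%N) // !add0n => le_q.
rewrite p_E // bin_small ?ltnS // (@bin_small (q - 1)); last by lia.
have i1 : (1 <= i)%N by lia.
rewrite /bin_shift i1 (@bin_small (q - 2)); last by lia.
rewrite !muln0 !add0n big_nat_cond big1 // => s /andP[/andP[s2 sq] _].
rewrite /star_term /bin_shift; case: ifP => [le_s|]; last by rewrite muln0.
rewrite (@bin_small (_ + _)) ?muln0 //.
have := @bin3_add (q - s) (s - 1).
have -> : (q - s + (s - 1) = q - 1)%N by lia.
have Cq : 'C(q, 3) = ('C(q - 1, 3) + 'C(q - 1, 2))%N.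
  have q0 : (0 < q)%N by lia.
  by rewrite -{1}(subnK q0) addn1 binS.
have h4 : (4 <= q - 1)%N by lia.
by move=> /(_ h4); lia.
Qed.

Lemma has_length_exists (k : fieldType) n (F : free_seq k n) N :
  rk F 0 <> 0%N -> (forall j, (N <= j)%N -> rk F j = 0%N) -> exists l, has_length F l.
Proof.
move=> F0 FN; have ex : exists j, rk F j != 0%N by exists 0%N; apply/eqP.
have ub j : rk F j != 0%N -> (j <= N)%N.
  by rewrite leqNgt; apply: contraNN => lt; rewrite FN // ltnW.
case: (ex_maxnP ex ub) => l /eqP nz max_l; exists l; split=> // j lt_lj.
by apply/eqP; apply: contraTT lt_lj => /max_l; rewrite leqNgt.
Qed.

(** * The extremal ideal *)

Section ProjectiveDimension.

Variables (k : fieldType) (n q : nat) (m : 'I_q -> 'X_{1..n}).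
Hypotheses (m_sqfree : forall i, squarefree_monom (m i)) (q5 : (5 <= q)%N).

Lemma rk0_minres_power3 : rk (minres (@power3 k n q m)) 0 <> 0%N.
Proof.
have [_ [aug_im _ _] _] := minres_power3 k m.
move: (minres _) aug_im => F aug_im rk0.
have i : 'I_q by apply: (@Ordinal q 0); lia.
have [x cx xE] := label_prod3 m i i i.
have /aug_im[v] : @power3 k n q m 'X_[label m x].
  apply/power3E; exists (fun y => (y == x)%:R).
  rewrite (bigD1 x) ?scarf1 //= eqxx mul1r big1 ?addr0 // => y /andP[_ /negPf->].
  by rewrite mul0r.
move=> /matrixP/(_ 0 0); rewrite !mxE eqxx big1 => [|r _]; last first.
  by suff: (r < 0)%N by []; rewrite -[X in (_ < X)%N]rk0; apply: ltn_ord.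
move/(congr1 (mcoeff (label m x))); rewrite mcoeff0 mcoeffX eqxx => /esym/eqP.
by rewrite oner_eq0.
Qed.

Lemma pd_power3_length :
  has_length (minres (@power3 k n q m)) (pd (@power3 k n q m)).
Proof.
apply: epsilon_spec; apply: (has_length_exists (N := 'C(q, 3))) rk0_minres_power3 _ => j le_j.
by apply/eqP; rewrite -leqn0 -(bound_eq0 q5 le_j); apply: betti_power3_le.
Qed.

Lemma pd_power3_le : (pd (@power3 k n q m) <= 'C(q, 3) - 1)%N.
Proof.
have [nz _] := pd_power3_length; move: (pd _) nz => l nz.
have C0 : (0 < 'C(q, 3))%N by rewrite bin_gt0; lia.
rewrite -ltnS subn1 prednK // ltnNge; apply/negP => le_l; apply: nz.
by apply/eqP; rewrite -leqn0 -(bound_eq0 q5 le_l); apply: betti_power3_le.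
Qed.

End ProjectiveDimension.

Section Extremal.

Variables (k : fieldType) (q : nat).

(** The exponent vector of epsilon_i. *)
Definition extremal_mnm (i : 'I_q) : 'X_{1..#|nonempty_set q|} :=
  (\sum_(A : nonempty_set q | i \in val A) U_(enum_rank A))%MM.

Lemma extremal_mnmE i (A : nonempty_set q) :
  extremal_mnm i (enum_rank A) = (i \in val A) :> nat.
Proof.
rewrite mnm_sumE; case: (boolP (i \in val A)) => iA.
  rewrite (bigD1 A) //= mnm1E eqxx big1 // => B /andP[_ ne].
  by rewrite mnm1E (inj_eq enum_rank_inj) (negPf ne).
apply: big1 => B iB; rewrite mnm1E (inj_eq enum_rank_inj).
by case: eqP => // E; rewrite -E iB in iA.
Qed.

Lemma extremal_mnm_sqfree i : squarefree_monom (extremal_mnm i).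
Proof. by move=> j; rewrite -(enum_valK j) extremal_mnmE; case: (_ \in _). Qed.

Lemma extremal_ideal_monomial :
  @extremal_ideal k q = @monomial_ideal k _ q extremal_mnm.
Proof.
rewrite /extremal_ideal /monomial_ideal.
suff -> : @extremal_gen k q = fun i => 'X_[extremal_mnm i] by [].
by apply: functional_extensionality => i; rewrite /extremal_gen mprodXE.
Qed.

(** The variable x_A for the set A of [scarf_strict_pos] tells the lcm over a face from
    the lcm without the vertex v. *)
Lemma extremal_minimal : minimal_seq (scarf_seq k extremal_mnm).
Proof.
apply: simplicial_minimal => s v Ks vs.
have [A A0 A_lt] := scarf_strict_pos Ks vs.
have nzA : A != set0.
  by apply: contraTneq A0 => ->; case: (v) => [[i j]|X]; rewrite /= ?inE ?setI0 ?cards0.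
have labE x : label extremal_mnm x (enum_rank (Sub A nzA : nonempty_set q)) = wt x A.
  rewrite (label_wt extremal_mnm_sqfree); congr wt; apply/setP => i.
  by rewrite inE extremal_mnmE SubK; case: (i \in A).
apply/eqP => /mnmP/(_ (enum_rank (Sub A nzA : nonempty_set q))); rewrite !mnmE => E.
suff: (wt v A < wt v A)%N by rewrite ltnn.
rewrite -{1}labE.
apply: leq_ltn_trans (leq_bigmax_cond (F := fun t => label extremal_mnm t _) _ vs) _.
rewrite -E; case: (wt v A) A0 A_lt => // w _ A_lt; rewrite ltnS.
apply/bigmax_leqP => x /setD1P[ne xs]; rewrite labE -ltnS; exact: A_lt.
Qed.

Hypothesis q5 : (5 <= q)%N.

Lemma betti_extremal i :
  betti (ideal_exp (@extremal_ideal k q) 3) i = ('C('C(q, 3), i.+1) + p_ i q)%N.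
Proof.
rewrite extremal_ideal_monomial; apply/eqP; rewrite eqn_leq.
rewrite (betti_power3_le k extremal_mnm_sqfree q5) /= -(rk_scarf_seq k extremal_mnm q5).
have [_ res _] := minres_power3 k extremal_mnm.
by apply: minimal_rk_le (scarf_seq_resolves k extremal_mnm_sqfree) res extremal_minimal.
Qed.

Lemma pd_extremal : pd (ideal_exp (@extremal_ideal k q) 3) = ('C(q, 3) - 1)%N.
Proof.
have b i := betti_extremal i; rewrite extremal_ideal_monomial in b *.
have le := pd_power3_le k extremal_mnm_sqfree q5.
have [_ top] := pd_power3_length k extremal_mnm_sqfree q5.
apply/eqP; rewrite eqn_leq le /= leqNgt; apply/negP => /top.
have C0 : (0 < 'C(q, 3))%N by rewrite bin_gt0; lia.
have := b ('C(q, 3) - 1)%N; rewrite /betti subn1 prednK // binn => -> //.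
Qed.

End Extremal.

Theorem theorem1p5 (k : fieldType) :
  (forall i : nat, exists P : {poly rat},
      size P = (3 * i + 2).+1 /\
      forall q : nat, (5 <= q)%N -> (p_ i q)%:R = P.[q%:R])
  /\
  (forall q : nat, (5 <= q)%N ->
     (forall (n : nat) (m : 'I_q -> 'X_{1..n}),
        (forall j, squarefree_monom (m j)) ->
        let I3 := ideal_exp (@monomial_ideal k n q m) 3 in
        (forall i : nat, (i <= 'C(q, 3))%N ->
           (betti I3 i <= 'C('C(q, 3), i.+1) + p_ i q)%N)
        /\ (pd I3 <= 'C(q, 3) - 1)%N)
     /\
     (let E3 := ideal_exp (@extremal_ideal k q) 3 in
      (forall i : nat, betti E3 i = ('C('C(q, 3), i.+1) + p_ i q)%N)
      /\ pd E3 = ('C(q, 3) - 1)%N)).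
Proof.
split=> [i|q q5]; first exact: p_polynomial.
split=> [n m m_sqfree|]; split.
- by move=> i _; apply: betti_power3_le.
- exact: pd_power3_le.
- by move=> i; apply: betti_extremal.
- exact: pd_extremal.
Qed.
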